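(* Let $\mu$ be a computable probability measure on $\{0,1\}^{\mathbb{N}}$, let $T:\{0,1\}^{\mathbb{N}}\to\{0,1\}^{\mathbb{N}}$ be a $\mu$-a.e. computable map, and let $Y\in\{0,1\}^{\mathbb{N}}$ be $\mu_T$-computably random. Then $Y=T(X)$ for some $\mu$-computably random $X\in\{0,1\}^{\mathbb{N}}$.
   Context: A partial map $T$ is $\mu$-a.e. computable if it is partial computable and $\mu(\mathrm{dom}\,T)=1$. $\mu_T(A)=\mu(T^{-1}(A))$ is the push-forward measure. For a computable measure $\nu$ on $\{0,1\}^{\mathbb{N}}$, $Z$ is $\nu$-computably random iff $t(Z)<\infty$ for every lower semicomputable $t:\{0,1\}^{\mathbb{N}}\to[0,\infty]$ and every computable measure $\kappa$ with $\int_{[\sigma]}t\,d\nu\le\kappa([\sigma])$ for all strings $\sigma$ (equivalently, no computable $\nu$-martingale succeeds on $Z$). *)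

(* Defs.v *)
From HB Require Import structures.
From mathcomp Require Import all_boot all_order all_algebra.
From mathcomp Require Import all_classical all_reals all_analysis.
Set Implicit Arguments. Unset Strict Implicit. Unset Printing Implicit Defensive.
Import Order.TTheory GRing.Theory Num.Theory.
Local Open Scope classical_set_scope.
Inductive code : Type :=
| CZero : code
| CSucc : code
| CProj : nat -> code
| CComp : code -> list code -> code
| CPrec : code -> code -> code
| CMu   : code -> code.

Inductive eval : code -> seq nat -> nat -> Prop :=
| ev_zero xs : eval CZero xs 0
| ev_succ x xs : eval CSucc (x :: xs) x.+1
| ev_proj i xs : i < size xs -> eval (CProj i) xs (nth 0 xs i)
| ev_comp f gs xs ys y : evals gs xs ys -> eval f ys y -> eval (CComp f gs) xs y
| ev_prec0 f g xs y : eval f xs y -> eval (CPrec f g) (0 :: xs) y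
| ev_precS f g n xs z y : eval (CPrec f g) (n :: xs) z ->
    eval g (n :: z :: xs) y -> eval (CPrec f g) (n.+1 :: xs) y
| ev_mu f xs n : eval f (n :: xs) 0 ->
    (forall m, m < n -> exists k, eval f (m :: xs) k.+1) -> eval (CMu f) xs n
with evals : list code -> seq nat -> seq nat -> Prop :=
| evs_nil xs : evals nil xs [::]
| evs_cons g gs xs y ys : eval g xs y -> evals gs xs ys -> evals (g :: gs) xs (y :: ys).

Definition computable1 (f : nat -> nat) : Prop :=
  exists c, forall a, eval c [:: a] (f a).
Definition computable2 (f : nat -> nat -> nat) : Prop :=
  exists c, forall a b, eval c [:: a; b] (f a b).

Definition bits := seq bool.

(* bijective base-2 coding of binary strings by naturals *)
Fixpoint enc (s : bits) : nat :=
  match s with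
  | [::] => 0
  | b :: s' => (enc s').*2 + (if b then 2 else 1)
  end.

Definition is_prefix (s : bits) (X : nat -> bool) : Prop :=
  forall i, (i < size s)%N -> X i = nth false s i.

Definition sprefix (s t : bits) : bool := s == take (size s) t.

Definition restr (X : nat -> bool) (n : nat) : bits := mkseq X n.

Definition cyl (s : bits) : set (nat -> bool) := [set X | is_prefix s X].

(* Cantor space {0,1}^N with its Borel sigma-algebra, i.e. the
   sigma-algebra generated by the cylinders *)
Definition cantor := g_sigma_algebraType (range cyl).

Local Open Scope ring_scope.

Definition qv {R : realType} (p q : nat) : R := p%:R / q.+1%:R.

Definition computable_measure {R : realType} (nu : set cantor -> \bar R) : Prop :=
  exists p q : nat -> nat -> nat, computable2 p /\ computable2 q /\
    forall (s : bits) (n : nat), exists r : R,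
      nu (cyl s) = r%:E /\
      `| qv (p (enc s) n) (q (enc s) n) - r | <= (2%:R ^- n : R).

(* t : {0,1}^N -> [0,oo] is lower semicomputable: t is the supremum of a
   computable enumeration of basic step functions q_k * 1_[w_k] *)
Definition lower_semicomputable {R : realType} (t : cantor -> \bar R) : Prop :=
  exists (w : nat -> bits) (p q : nat -> nat),
    computable1 (fun k => enc (w k)) /\ computable1 p /\ computable1 q /\
    forall X : cantor,
      t X = ereal_sup ([set 0%E] `|`
              [set (qv (p k) (q k) : R)%:E | k in [set k | is_prefix (w k) X]]).

(* T : {0,1}^N -> {0,1}^N partial computable (None = undefined): there is a
   computable monotone phi on strings such that T(X) is defined iff the
   outputs phi(X|n) grow unboundedly, and then T(X) is their limit *)
Definition partial_computable (T : cantor -> option cantor) : Prop :=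
  exists (phi : bits -> bits) (g : nat -> nat),
    computable1 g /\ (forall s, g (enc s) = enc (phi s)) /\
    (forall s t, sprefix s t -> sprefix (phi s) (phi t)) /\
    forall (X Y : cantor),
      T X = Some Y <->
      ((forall n, is_prefix (phi (restr X n)) Y) /\
       (forall m, exists n, (m <= size (phi (restr X n)))%N)).

Definition ae_computable {R : realType} (mu : set cantor -> \bar R)
  (T : cantor -> option cantor) : Prop :=
  partial_computable T /\ mu [set X | T X != None] = 1%E.

Definition is_pushforward {R : realType} (mu nu : set cantor -> \bar R)
  (T : cantor -> option cantor) : Prop :=
  forall A : set cantor, measurable A ->
    nu A = mu [set X | exists Y, T X = Some Y /\ A Y].

Definition computably_random {R : realType} (nu : {measure set cantor -> \bar R})
  (Z : cantor) : Prop :=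
  forall (t : cantor -> \bar R) (kappa : {measure set cantor -> \bar R}),
    lower_semicomputable t -> computable_measure kappa ->
    (forall s : bits, (\int[nu]_(x in cyl s) t x <= kappa (cyl s))%E) ->
    (t Z < +oo)%E.

(* Main.v *)
(** Let [A_m] be the set of [X] with [T X] in the cylinder of [Y|m]. For a
    [mu]-test [t] bounded by [kappa], the integral of [t] over [A_m] is almost a
    computable [nu]-supermartingale, but [T] need not be defined [kappa]-almost
    everywhere. So one chooses computable stages [st n] at which [T] has produced [n]
    bits except on a set [C n] of [mu]-measure at most [4^-n], and integrates only
    outside the [C n] with [n >= n0]. The resulting weight, computed from [kappa] at a
    finite stage, is superadditive, hence at most [B * nu] along the random point [Y];
    the same argument applied to [sum_n 2^n mu(C n)] shows that a single [n0]
    discards at most a quarter of every [A_m]. There are countably many tests, so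
    Markov's inequality for a weighted sum of them gives, for every [m], a point of
    [A_m] outside the [C n] on which every test is bounded independently of [m].
    A cluster point of these points works, since tests are lower semicontinuous. *)

(* Each test has its own constant along [Y], but [n0] must serve all of them; hence the discarded
   mass is controlled by a weight [theta] built from [mu] alone, before any test is considered.
   Randomness of [Y] only says that tests are finite at [Y], whereas a bound on the ratio of a
   weight to [nu] at every prefix of [Y] is needed. The test applied to [Y] therefore counts the
   powers of two that the ratio has passed: a bounded integer level eventually stops moving, and a
   level at rest bounds the ratio itself. Discarding the [C n] serves two ends. Before the limit, it
   replaces the preimage of a cylinder by a finite union of cylinders, whose [kappa]-measure is
   computable and superadditive even if [kappa] charges points where [T] is undefined. In the limit,
   avoiding [C n] is a condition on the first [st n] bits that guarantees [n] bits of output; it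
   passes to the cluster point, so [T] is defined there, and comparing outputs shows that the value
   is [Y]. The rate [4 ^- n] keeps the sum of [2 ^+ n * mu (C n)] convergent, and the factor
   [2 ^+ n] is what makes the loss beyond [n0] of order [2 ^- n0]. *)
Require Import Defs.
From HB Require Import structures.
From mathcomp Require Import all_boot all_order all_algebra.
From mathcomp Require Import all_classical all_reals all_analysis.
From mathcomp Require Import measurable_realfun.
From mathcomp Require Import zify lra ring.
Set Implicit Arguments. Unset Strict Implicit. Unset Printing Implicit Defensive.
Import Order.TTheory GRing.Theory Num.Theory.
Local Open Scope classical_set_scope.
Local Open Scope nat_scope.

(** * Closure properties of the computable functions *)

(* Environments of [k] natural numbers, the most recent variable outermost. *)
Fixpoint env (k : nat) : Type := if k is k'.+1 then (env k' * nat)%type else unit.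

Fixpoint env_seq {k} : env k -> seq nat :=
  if k is k'.+1 then fun x : env k'.+1 => x.2 :: env_seq x.1 else fun _ => [::].

Definition computable k (f : env k -> nat) : Prop :=
  exists c, forall x, Defs.eval c (env_seq x) (f x).

Lemma computable1P f : computable1 f <-> @computable 1 (fun x => f x.2).
Proof.
split=> -[c h]; exists c; first by case=> -[] a; apply: h.
by move=> a; apply: (h (tt, a)).
Qed.

Lemma computable2P f : computable2 f <-> @computable 2 (fun x => f x.2 x.1.2).
Proof.
split=> -[c h]; exists c; first by case=> -[[] b] a; apply: h.
by move=> a b; apply: (h (tt, b, a)).
Qed.

Lemma comp_ext k (f g : env k -> nat) : f =1 g -> computable f -> computable g.
Proof. by move=> fg [c h]; exists c => x; rewrite -fg. Qed.

Lemma size_env_seq k (x : env k) : size (env_seq x) = k.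
Proof. by elim: k x => //= k IH x; rewrite IH. Qed.

Lemma comp_nth k i : i < k -> @computable k (fun x => nth 0 (env_seq x) i).
Proof. by move=> ik; exists (CProj i) => x; apply: ev_proj; rewrite size_env_seq. Qed.

Lemma comp_v0 k : @computable k.+1 (fun x => x.2).
Proof. exact: (@comp_nth k.+1 0). Qed.
Lemma comp_v1 k : @computable k.+2 (fun x => x.1.2).
Proof. exact: (@comp_nth k.+2 1). Qed.
Lemma comp_v2 k : @computable k.+3 (fun x => x.1.1.2).
Proof. exact: (@comp_nth k.+3 2). Qed.
Lemma comp_v3 k : @computable k.+4 (fun x => x.1.1.1.2).
Proof. exact: (@comp_nth k.+4 3). Qed.
Lemma comp_v4 k : @computable k.+4.+1 (fun x => x.1.1.1.1.2).
Proof. exact: (@comp_nth k.+4.+1 4). Qed.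
Lemma comp_v5 k : @computable k.+4.+2 (fun x => x.1.1.1.1.1.2).
Proof. exact: (@comp_nth k.+4.+2 5). Qed.

Lemma comp_const k n : @computable k (fun=> n).
Proof.
elim: n => [|n [c h]]; first by exists CZero => x; apply: ev_zero.
exists (CComp CSucc [:: c]) => x; apply: ev_comp (ev_succ n [::]).
by apply: evs_cons (evs_nil _).
Qed.

Lemma evals_env_suffix (xs ys : seq nat) :
  evals [seq CProj i | i <- iota (size xs) (size ys)] (xs ++ ys) ys.
Proof.
elim: ys xs => [|y ys IH] xs /=; first exact: evs_nil.
apply: evs_cons.
  have := @ev_proj (size xs) (xs ++ y :: ys).
  by rewrite nth_cat ltnn subnn size_cat /=; apply; lia.
by have := IH (rcons xs y); rewrite size_rcons cat_rcons.
Qed.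

Definition computable_env m k (r : env m -> env k) : Prop :=
  exists cs, forall x, evals cs (env_seq x) (env_seq (r x)).

Lemma comp_env m k (F : env k -> nat) (r : env m -> env k) :
  computable F -> computable_env r -> computable (fun x => F (r x)).
Proof. by move=> [c h] [cs hs]; exists (CComp c cs) => x; apply: ev_comp (hs x) (h _). Qed.

Lemma cenv_tt m : @computable_env m 0 (fun=> tt).
Proof. by exists nil => x; apply: evs_nil. Qed.

Lemma cenv_id k : @computable_env k k id.
Proof.
exists [seq CProj i | i <- iota 0 k] => x.
by have := @evals_env_suffix [::] (env_seq x); rewrite size_env_seq.
Qed.

Lemma cenv_1 k : @computable_env k.+1 k fst.
Proof.
exists [seq CProj i | i <- iota 1 k] => -[x i].
by have := @evals_env_suffix [:: i] (env_seq x); rewrite size_env_seq.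
Qed.

Lemma cenv_11 k : @computable_env k.+2 k (fun x => x.1.1).
Proof.
exists [seq CProj i | i <- iota 2 k] => -[[x j] i].
by have := @evals_env_suffix [:: i; j] (env_seq x); rewrite size_env_seq.
Qed.

Lemma cenv_pair m k (r : env m -> env k) (f : env m -> nat) :
  computable_env r -> computable f -> @computable_env m k.+1 (fun x => (r x, f x)).
Proof. by move=> [cs hs] [c h]; exists (c :: cs) => x; apply: evs_cons (h x) (hs x). Qed.

Lemma comp_app1 k (F : env 1 -> nat) (f : env k -> nat) :
  computable F -> computable f -> computable (fun x => F (tt, f x)).
Proof. by move=> hF hf; apply: (comp_env hF); apply: cenv_pair (cenv_tt _) hf. Qed.

Lemma comp_app2 k (F : env 2 -> nat) (f g : env k -> nat) :
  computable F -> computable f -> computable g -> computable (fun x => F (tt, g x, f x)).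
Proof.
by move=> hF hf hg; apply: (comp_env hF); do 2! apply: cenv_pair => //; apply: cenv_tt.
Qed.

Lemma comp_subst k (F : env k.+1 -> nat) (f : env k -> nat) :
  computable F -> computable f -> computable (fun x => F (x, f x)).
Proof. by move=> hF hf; apply: (comp_env hF); apply: cenv_pair (cenv_id _) hf. Qed.

Lemma comp_weak k (f : env k -> nat) : computable f -> @computable k.+1 (fun x => f x.1).
Proof. by move=> hf; apply: (comp_env hf); apply: cenv_1. Qed.

Lemma comp_rec k (b : env k -> nat) (s : env k -> nat -> nat -> nat) (n : env k -> nat) :
  computable b -> @computable k.+2 (fun p => s p.1.1 p.2 p.1.2) -> computable n ->
  computable (fun x => nat_rect (fun=> nat) (b x) (s x) (n x)).
Proof.
move=> [cb hb] [cs hs] hn.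
apply: (@comp_subst k (fun p => nat_rect (fun=> nat) (b p.1) (s p.1) p.2)) hn.
exists (CPrec cb cs) => -[x m] /=.
elim: m => [|m IH] /=; first by apply: ev_prec0.
by apply: ev_precS IH _; have := hs (x, nat_rect (fun=> nat) (b x) (s x) m, m).
Qed.

Lemma comp_min k (f : env k -> nat -> nat) :
  @computable k.+1 (fun p => f p.1 p.2) -> (forall x, exists n, f x n = 0) ->
  exists2 m : env k -> nat, computable m & forall x, f x (m x) = 0.
Proof.
move=> [c h] ex.
have ex' x : exists n, f x n == 0 by have [n /eqP] := ex x; exists n.
exists (fun x => ex_minn (ex' x)); last by move=> x; case: ex_minnP => m /eqP.
exists (CMu c) => x; case: ex_minnP => m /eqP m0 mmin.
apply: ev_mu; first by rewrite -m0; apply: (h (x, m)).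
move=> j jm; exists (f x j).-1.
have fj : f x j != 0 by apply/negP => /mmin; lia.
by rewrite prednK ?lt0n //; apply: (h (x, j)).
Qed.

Lemma comp_succ k (f : env k -> nat) : computable f -> computable (fun x => (f x).+1).
Proof.
apply: (@comp_app1 k (fun p => p.2.+1)).
by exists CSucc => -[[] a]; apply: ev_succ.
Qed.

Lemma comp_add k (f g : env k -> nat) : computable f -> computable g -> computable (fun x => f x + g x).
Proof.
move=> hf hg; pose s (x : env k) (i acc : nat) := acc.+1.
have : computable (fun x => nat_rect (fun=> nat) (f x) (s x) (g x)).
  by apply: comp_rec => //; apply: comp_succ; apply: comp_v1.
by apply: comp_ext => x; elim: (g x) => [|m /= ->]; rewrite ?addn0 ?addnS.
Qed.

Lemma comp_mul k (f g : env k -> nat) : computable f -> computable g -> computable (fun x => f x * g x).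
Proof.
move=> hf hg; pose s (x : env 1) (i acc : nat) := acc + x.2.
apply: (@comp_app2 k (fun p => p.2 * p.1.2)) hf hg.
have : @computable 2 (fun x => nat_rect (fun=> nat) 0 (fun i acc => acc + x.2) x.1.2).
  apply: (@comp_rec 2 _ (fun x i acc => acc + x.2)).
  - exact: comp_const.
  - by apply: comp_add; [apply: comp_v1 | apply: comp_v2].
  - exact: comp_v1.
by apply: comp_ext => x; elim: (x.1.2) => [|m /= ->]; rewrite ?muln0 // mulnS addnC.
Qed.

Lemma comp_pred k (f : env k -> nat) : computable f -> computable (fun x => (f x).-1).
Proof.
apply: (@comp_app1 k (fun p => p.2.-1)).
have : @computable 1 (fun x => nat_rect (fun=> nat) 0 (fun i acc => i) x.2).
  apply: (@comp_rec 1 _ (fun x i acc => i)); first exact: comp_const.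
    exact: comp_v0.
  exact: comp_v0.
by apply: comp_ext => x; case: (x.2).
Qed.

Lemma comp_sub k (f g : env k -> nat) : computable f -> computable g -> computable (fun x => f x - g x).
Proof.
move=> hf hg; pose s (x : env k) (i acc : nat) := acc.-1.
have : computable (fun x => nat_rect (fun=> nat) (f x) (s x) (g x)).
  by apply: comp_rec => //; apply: comp_pred; apply: comp_v1.
by apply: comp_ext => x; elim: (g x) => [|m /= ->]; rewrite ?subn0 ?subnS.
Qed.

Lemma comp_leq k (f g : env k -> nat) : computable f -> computable g -> computable (fun x => f x <= g x : nat).
Proof.
move=> hf hg; have := comp_sub (comp_const k 1) (comp_sub hf hg).
by apply: comp_ext => x; case: (leqP (f x) (g x)); lia.
Qed.

Lemma comp_and k (f g : env k -> bool) :
  computable (fun x => f x : nat) -> computable (fun x => g x : nat) -> computable (fun x => f x && g x : nat).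
Proof.
by move=> hf hg; apply: comp_ext (comp_mul hf hg) => x; rewrite mulnb.
Qed.

Lemma comp_not k (f : env k -> bool) :
  computable (fun x => f x : nat) -> computable (fun x => ~~ f x : nat).
Proof.
move=> hf; apply: comp_ext (comp_sub (comp_const k 1) hf) => x.
by case: (f x).
Qed.

Lemma comp_eq k (f g : env k -> nat) : computable f -> computable g -> computable (fun x => f x == g x : nat).
Proof.
move=> hf hg; have := comp_and (comp_leq hf hg) (comp_leq hg hf).
by apply: comp_ext => x; rewrite eqn_leq.
Qed.

Lemma comp_sum k (F : env k -> nat -> nat) (b : env k -> nat) :
  @computable k.+1 (fun p => F p.1 p.2) -> computable b -> computable (fun x => \sum_(i < b x) F x i).
Proof.
move=> hF hb.
have : computable (fun x => nat_rect (fun=> nat) 0 (fun i acc => acc + F x i) (b x)).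
  apply: (@comp_rec k _ (fun x i acc => acc + F x i)) => //; first exact: comp_const.
  apply: comp_add; first exact: comp_v1.
  apply: (@comp_env k.+2 k.+1 (fun p => F p.1 p.2) (fun p => (p.1.1, p.2)) hF).
  exact: cenv_pair (cenv_11 _) (comp_v0 _).
by apply: comp_ext => x; elim: (b x) => [|m /= ->]; rewrite ?big_ord0 // big_ord_recr.
Qed.

Lemma comp_expn k (f g : env k -> nat) : computable f -> computable g -> computable (fun x => f x ^ g x).
Proof.
apply: (@comp_app2 k (fun p => p.2 ^ p.1.2)).
have : @computable 2 (fun x => nat_rect (fun=> nat) 1 (fun i acc => acc * x.2) x.1.2).
  apply: (@comp_rec 2 _ (fun x i acc => acc * x.2)).
  - exact: comp_const.
  - by apply: comp_mul; [apply: comp_v1 | apply: comp_v2].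
  - exact: comp_v1.
by apply: comp_ext => x; elim: (x.1.2) => [|m /= ->] //; rewrite expnSr.
Qed.

Lemma sum_leq_count b m : (\sum_(i < b) (i < m)) = minn b m.
Proof.
elim: b => [|b IH]; first by rewrite big_ord0 min0n.
by rewrite big_ord_recr /= IH; lia.
Qed.

Lemma comp_div k (f g : env k -> nat) : computable f -> computable g -> computable (fun x => f x %/ g x).
Proof.
apply: (@comp_app2 k (fun p => p.2 %/ p.1.2)).
(* The quotient counts the positive multiples of the divisor up to the dividend. The first factor
   yields the convention [m %/ 0 = 0], where the count alone would give [m]. *)
have : @computable 2 (fun x => (1 <= x.1.2) * \sum_(i < x.2) (i.+1 * x.1.2 <= x.2)).
  apply: comp_mul; first by apply: comp_leq; [apply: comp_const | apply: comp_v1].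
  apply: (@comp_sum 2 (fun x i => i.+1 * x.1.2 <= x.2)); last exact: comp_v0.
  apply: comp_leq; last exact: comp_v1.
  by apply: comp_mul; [apply: comp_succ; apply: comp_v0 | apply: comp_v2].
apply: comp_ext => -[[[] d] m] /=; case: (posnP d) => [->|d0]; first by rewrite divn0.
under eq_bigr do rewrite -leq_divRL //.
by rewrite sum_leq_count mul1n; apply/minn_idPr; rewrite leq_div.
Qed.

Lemma comp_mod k (f g : env k -> nat) : computable f -> computable g -> computable (fun x => f x %% g x).
Proof.
move=> hf hg; apply: comp_ext (comp_sub hf (comp_mul (comp_div hf hg) hg)) => x.
by rewrite {1}(divn_eq (f x) (g x)) addKn.
Qed.

(** Serves the tactic below: in a goal the summand is a function of an ordinal whose type depends on
    [x], and the first premise recovers from it a function on plain naturals, as [comp_sum]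
    requires. *)
Lemma comp_sum_ord k (b : env k -> nat) (G : forall x, 'I_(b x) -> nat) F :
  (forall x i (h : i < b x), G x (Ordinal h) = F x i) ->
  @computable k.+1 (fun p => F p.1 p.2) -> computable b ->
  computable (fun x => \sum_(i < b x) G x i).
Proof.
move=> GF hF hb; apply: comp_ext (comp_sum hF hb) => x.
by apply: eq_bigr => -[i h] _; rewrite GF.
Qed.

Ltac comp_leaf := first [ assumption | exact: comp_v0 | exact: comp_v1 | exact: comp_v2
  | exact: comp_v3 | exact: comp_v4 | exact: comp_v5 | exact: comp_const
  | (apply: comp_weak; assumption) ].

Ltac comp_step := cbv beta; first [ comp_leaf
  | lazymatch goal with
    | |- computable (fun x => @bigop.body (@?R x) (@?I x) (@?z x) (@?r x) (@?F x)) =>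
        eapply comp_sum_ord; [intros ? ? ?; cbn [nat_of_ord]; reflexivity | | ]
    | |- computable (fun x => nat_of_bool (leq (@?a x) (@?b x))) => apply: (@comp_leq _ a b)
    | |- computable (fun x => nat_of_bool (andb (@?a x) (@?b x))) => apply: (@comp_and _ a b)
    | |- computable (fun x => nat_of_bool (negb (@?a x))) => apply: (@comp_not _ a)
    | |- computable (fun x => nat_of_bool (eq_op (@?a x) (@?b x))) => apply: (@comp_eq _ a b)
    | |- computable (fun x => S (@?a x)) => apply: (@comp_succ _ a)
    | |- computable (fun x => addn (@?a x) (@?b x)) => apply: (@comp_add _ a b)
    | |- computable (fun x => subn (@?a x) (@?b x)) => apply: (@comp_sub _ a b)
    | |- computable (fun x => muln (@?a x) (@?b x)) => apply: (@comp_mul _ a b)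
    | |- computable (fun x => Nat.pred (@?a x)) => apply: (@comp_pred _ a)
    | |- computable (fun x => expn (@?a x) (@?b x)) => apply: (@comp_expn _ a b)
    | |- computable (fun x => divn (@?a x) (@?b x)) => apply: (@comp_div _ a b)
    | |- computable (fun x => modn (@?a x) (@?b x)) => apply: (@comp_mod _ a b)
    end ].
Ltac comp_tac := repeat comp_step.

(** * Binary strings as numbers *)

(** The binary expansion of [(enc s).+1] is a leading 1 followed by the bits of [s], the first bit
    being least significant. So the length is the integer logarithm of [e.+1], and taking a prefix
    is reduction modulo [2 ^ k] with a new leading 1. *)
Definition len (e : nat) := \sum_(i < e) (2 ^ i.+1 <= e.+1).
Definition tk (k e : nat) := ((e.+1 - 2 ^ len e) %% 2 ^ k + 2 ^ k).-1.
Definition pref (d e : nat) : bool := (len d <= len e) && (tk (len d) e == d).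

Lemma comp_len k f : computable f -> @computable k (fun x => len (f x)).
Proof. by apply: (@comp_app1 k (fun p => len p.2)); rewrite /len; comp_tac. Qed.

Lemma comp_tk k f g : computable f -> computable g -> @computable k (fun x => tk (f x) (g x)).
Proof.
apply: (@comp_app2 k (fun p => tk p.2 p.1.2)); rewrite /tk; comp_tac.
by apply: comp_len; comp_tac.
Qed.

Lemma comp_pref k f g : computable f -> computable g -> @computable k (fun x => pref (f x) (g x)).
Proof.
apply: (@comp_app2 k (fun p => pref p.2 p.1.2)); rewrite /pref; comp_tac;
  try (apply: comp_len; comp_tac).
by apply: comp_tk; comp_tac; apply: comp_len; comp_tac.
Qed.

Fixpoint bin_val (s : bits) : nat := if s is b :: s' then b + (bin_val s').*2 else 0.

Lemma bin_val_lt s : bin_val s < 2 ^ size s.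
Proof. by elim: s => //= b s IH; rewrite expnS; case: b; lia. Qed.

Lemma encS s : (enc s).+1 = bin_val s + 2 ^ size s.
Proof. by elim: s => //= b s IH; rewrite expnS; case: b; lia. Qed.

Lemma enc_inj : injective enc.
Proof.
elim=> [|b s IH] [|c t] //=; [by case: c; lia | by case: b; lia |].
move=> h; have st : enc s = enc t by move: h; case: b; case: c; lia.
by rewrite (IH _ st); congr cons; move: h; rewrite st; case: b; case: c; lia.
Qed.

Lemma len_enc s : len (enc s) = size s.
Proof.
have bd := ltn_expl (size s) (ltnSn 1); have le := encS s; have lt := bin_val_lt s.
rewrite /len (eq_bigr (fun i : 'I_(enc s) => (i < size s : nat))) => [|i _].
  by rewrite sum_leq_count; lia.
congr nat_of_bool; apply/idP/idP => h.
  rewrite -ltnS -(ltn_exp2l _ _ (ltnSn 1)); apply: leq_ltn_trans h _.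
  by rewrite expnS; lia.
apply: (@leq_trans (2 ^ size s)); last lia.
by rewrite leq_exp2l.
Qed.

Lemma bin_val_take k s : k <= size s -> bin_val (take k s) = bin_val s %% 2 ^ k.
Proof.
elim: s k => [|b s IH] [|k] //= ks; rewrite ?modn1 // IH // expnS.
have lt := ltn_pmod (bin_val s) (expn_gt0 2 k : 0 < 2 ^ k).
rewrite [in RHS](divn_eq (bin_val s) (2 ^ k)).
have -> : b + (bin_val s %/ 2 ^ k * 2 ^ k + bin_val s %% 2 ^ k).*2 =
  bin_val s %/ 2 ^ k * (2 * 2 ^ k) + (b + (bin_val s %% 2 ^ k).*2) by lia.
by rewrite modnMDl [RHS]modn_small //; case: b; lia.
Qed.

Lemma tk_enc k s : k <= size s -> tk k (enc s) = enc (take k s).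
Proof.
move=> ks; rewrite /tk len_enc encS addnK -bin_val_take //.
by have := encS (take k s); rewrite size_takel // => <-.
Qed.

Lemma pref_enc s t : pref (enc s) (enc t) = sprefix s t.
Proof.
rewrite /pref !len_enc /sprefix; case: leqP => st /=.
  by rewrite tk_enc // (inj_eq enc_inj) eq_sym.
apply/esym/negbTE/eqP; rewrite take_oversize 1?ltnW // => h.
by rewrite h ltnn in st.
Qed.

Lemma enc_rcons s b : enc (rcons s b) = enc s + 2 ^ size s * (1 + b).
Proof. by elim: s => [|c s IH] /=; [case: b | rewrite IH expnS; lia]. Qed.

Lemma enc_surj e : exists s, enc s = e.
Proof.
elim/ltn_ind: e => -[|e] IH; first by exists [::].
have [s se] : exists s, enc s = e./2 by apply: IH; lia.
by exists (odd e :: s) => /=; rewrite se -{3}(odd_double_half e); case: (odd e); lia.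
Qed.

Definition dec (e : nat) : bits := projT1 (cid (enc_surj e)).

Lemma decK : cancel dec enc.
Proof. by move=> e; rewrite /dec; case: cid. Qed.

Lemma encK : cancel enc dec.
Proof. by move=> s; apply: enc_inj; rewrite decK. Qed.

Lemma size_dec e : size (dec e) = len e.
Proof. by rewrite -{2}(decK e) len_enc. Qed.

Fixpoint strs (L : nat) : seq bits :=
  if L is L'.+1 then [seq rcons s false | s <- strs L'] ++ [seq rcons s true | s <- strs L']
  else [:: [::]].

Lemma size_strs L s : s \in strs L -> size s = L.
Proof.
elim: L s => [|L IH] s /=; first by rewrite inE => /eqP->.
by rewrite mem_cat => /orP[] /mapP[t /IH <- ->]; rewrite size_rcons.
Qed.

Lemma big_strsS (V : nmodType) L (F : bits -> V) :
  (\sum_(s <- strs L.+1) F s = \sum_(s <- strs L) (F (rcons s false) + F (rcons s true)))%R.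
Proof. by rewrite /= big_cat !big_map big_split. Qed.

(** The codes of the strings of length [L] fill the interval of [2 ^ L] numbers starting at
    [2 ^ L - 1]; sums over strings thus become bounded sums, to which computability lemmas apply. *)
Lemma big_strs_enc (V : nmodType) L (F : nat -> V) :
  (\sum_(j < 2 ^ L) F (j + (2 ^ L).-1)%N = \sum_(s <- strs L) F (enc s))%R.
Proof.
elim: L F => [|L IH] F; first by rewrite big_ord1 big_seq1.
rewrite big_strsS big_split /=.
have e2 : 2 ^ L.+1 = 2 ^ L + 2 ^ L by rewrite expnS mul2n addnn.
have p : 0 < 2 ^ L by rewrite expn_gt0.
rewrite e2 big_split_ord /=.
have := IH (fun e => F (e + 2 ^ L)); have := IH (fun e => F (e + 2 ^ L * 2)) => /= h1 h0.
have -> : (\sum_(s <- strs L) F (enc (rcons s false)) =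
    \sum_(j < 2 ^ L) F (j + (2 ^ L).-1 + 2 ^ L)%N)%R.
  by rewrite h0; apply: eq_big_seq => s /size_strs sL; rewrite enc_rcons sL muln1.
have -> : (\sum_(s <- strs L) F (enc (rcons s true)) =
    \sum_(j < 2 ^ L) F (j + (2 ^ L).-1 + 2 ^ L * 2)%N)%R.
  by rewrite h1; apply: eq_big_seq => s /size_strs sL; rewrite enc_rcons sL.
by congr (_ + _)%R; apply: eq_bigr => j _; congr F; lia.
Qed.

Lemma size_restr X n : size (restr X n) = n.
Proof. exact: size_mkseq. Qed.

Lemma restrS X n : restr X n.+1 = rcons (restr X n) (X n).
Proof. by rewrite /restr /mkseq -addn1 iotaD map_cat cats1. Qed.

Lemma take_restr X k n : k <= n -> take k (restr X n) = restr X k.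
Proof. by move=> kn; rewrite /restr /mkseq -map_take take_iota (minn_idPl kn). Qed.

Lemma is_prefixE s X : is_prefix s X <-> restr X (size s) = s.
Proof.
split=> [h|<- i]; last by rewrite size_restr => i_s; rewrite nth_mkseq.
apply: (@eq_from_nth _ false); rewrite size_restr // => i i_s.
by rewrite nth_mkseq // h.
Qed.

Lemma is_prefix_restr X n : is_prefix (restr X n) X.
Proof. by apply/is_prefixE; rewrite size_restr. Qed.

Lemma sprefix_restr X m n : m <= n -> sprefix (restr X m) (restr X n).
Proof. by move=> mn; rewrite /sprefix size_restr take_restr. Qed.

Lemma is_prefix_sprefix s t X : size s <= size t -> is_prefix t X ->
  is_prefix s X <-> sprefix s t.
Proof.
move=> st /is_prefixE tX; rewrite is_prefixE /sprefix -tX take_restr //.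
by split=> [h|/eqP h]; [apply/eqP|]; apply: esym.
Qed.

Lemma sprefix_refl s : sprefix s s.
Proof. by rewrite /sprefix take_size. Qed.

Lemma sprefix_size s t : sprefix s t -> size s <= size t.
Proof. by move=> /eqP ->; rewrite size_take_min geq_minr. Qed.

Lemma sprefix_trans t s u : sprefix s t -> sprefix t u -> sprefix s u.
Proof.
move=> st; have le := sprefix_size st; move: st; rewrite /sprefix => /eqP st /eqP tu.
by apply/eqP; rewrite {1}st {1}tu take_takel.
Qed.

Lemma sprefix_rcons s b : sprefix s (rcons s b).
Proof. by rewrite /sprefix -cats1 take_size_cat. Qed.

(** * Enumerating the computable functions *)

Lemma code_list_ind (P : Defs.code -> Prop) :
  P CZero -> P CSucc -> (forall i, P (CProj i)) ->
  (forall f gs, P f -> List.Forall P gs -> P (CComp f gs)) ->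
  (forall f g, P f -> P g -> P (CPrec f g)) -> (forall f, P f -> P (CMu f)) ->
  forall c, P c.
Proof.
move=> h0 h1 h2 h3 h4 h5; fix IH 1 => -[||i|f gs|f g|f].
- exact: h0.
- exact: h1.
- exact: h2.
- by apply: h3 (IH f) _; elim: gs => [|g gs IHgs]; constructor.
- exact: h4 (IH f) (IH g).
- exact: h5 (IH f).
Qed.

Lemma eval_comp_inv f gs xs y :
  Defs.eval (CComp f gs) xs y -> exists2 ys, evals gs xs ys & Defs.eval f ys y.
Proof. by move=> h; inversion h; subst; eexists; eassumption. Qed.

Lemma evals_cons_inv g gs xs us : evals (g :: gs) xs us ->
  exists y ys, [/\ us = y :: ys, Defs.eval g xs y & evals gs xs ys].
Proof. by move=> h; inversion h; subst; do 2 eexists; split; [reflexivity|..]. Qed.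

Lemma eval_precS_inv f g n xs y : Defs.eval (CPrec f g) (n.+1 :: xs) y ->
  exists2 z, Defs.eval (CPrec f g) (n :: xs) z & Defs.eval g (n :: z :: xs) y.
Proof. by move=> h; inversion h; subst; eexists; eassumption. Qed.

Lemma eval_mu_inv f xs n : Defs.eval (CMu f) xs n ->
  Defs.eval f (n :: xs) 0 /\
  (forall m, m < n -> exists k, Defs.eval f (m :: xs) k.+1).
Proof. by move=> h; inversion h; subst. Qed.

(** Makes a code determine its function, which is what lets the tests be numbered by codes. *)
Lemma eval_inj c xs y z : Defs.eval c xs y -> Defs.eval c xs z -> y = z.
Proof.
elim/code_list_ind: c xs y z => [||i|f gs IHf IHgs|f g IHf IHg|f IHf] xs y z.
- by move=> h1 h2; inversion h1; inversion h2.
- by move=> h1 h2; inversion h1; subst; inversion h2.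
- by move=> h1 h2; inversion h1; inversion h2.
- have gs_inj us vs : evals gs xs us -> evals gs xs vs -> us = vs.
    elim: gs IHgs us vs => [|g gs IH] IHgs us vs.
      by move=> h1 h2; inversion h1; inversion h2.
    move=> /evals_cons_inv[a [as_ [-> ha has]]] /evals_cons_inv[b [bs [-> hb hbs]]].
    inversion IHgs as [|? ? Hg Hgs]; subst.
    by rewrite (Hg _ _ _ ha hb) (IH Hgs _ _ has hbs).
  move=> /eval_comp_inv[us hus hy] /eval_comp_inv[vs hvs hz].
  by apply: IHf hy _; rewrite (gs_inj _ _ hus hvs).
- case: xs => [|n xs]; first by move=> h; inversion h.
  elim: n y z => [|n IH] y z.
    move=> h1 h2; inversion h1 as [| | | |? ? ? ? hy| |]; subst.
    by inversion h2 as [| | | |? ? ? ? hz| |]; subst; apply: IHf hy hz.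
  move=> /eval_precS_inv[u hu hy] /eval_precS_inv[v hv hz].
  by apply: IHg hy _; rewrite (IH _ _ hu hv).
- move=> /eval_mu_inv[y0 hy] /eval_mu_inv[z0 hz].
  case: (ltngtP y z) => // yz.
    by have [k hk] := hz _ yz; have := IHf _ _ _ y0 hk.
  by have [k hk] := hy _ yz; have := IHf _ _ _ z0 hk.
Qed.

(** [GenTree.tree nat] is a countable type, so an injection into it numbers the codes. *)
Fixpoint code_tree (c : Defs.code) : GenTree.tree nat :=
  match c with
  | CZero => GenTree.Node 0 [::]
  | CSucc => GenTree.Node 1 [::]
  | CProj i => GenTree.Leaf i
  | CComp f gs => GenTree.Node 2 (code_tree f :: map code_tree gs)
  | CPrec f g => GenTree.Node 3 [:: code_tree f; code_tree g]
  | CMu f => GenTree.Node 4 [:: code_tree f]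
  end.

Lemma code_tree_inj : injective code_tree.
Proof.
elim/code_list_ind=> [||i|f gs IHf IHgs|f g IHf IHg|f IHf] [||j|f' gs'|f' g'|f'] //=.
- by case=> ->.
- case=> /IHf -> /=; elim: gs IHgs gs' => [|g gs IH] IHgs [|g' gs'] //= [hg hgs].
  inversion IHgs; subst; rewrite (H1 _ hg).
  by case: (IH H2 gs' hgs) => ->.
- by case=> /IHf -> /IHg ->.
- by case=> /IHf ->.
Qed.

Local Open Scope ring_scope.

(** * Computable families of reals *)

Section Approximation.
Context {R : realType}.

(* Dyadic approximations, up to a fixed number of units in the last place. *)
Definition approx k (F : env k -> R) : Prop :=
  exists a : env k.+1 -> nat, computable a /\
    exists K : nat, forall x n, `|(a (x, n))%:R - 2 ^+ n * F x| <= K%:R.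

Lemma approx_ext k (F G : env k -> R) : F =1 G -> approx F -> approx G.
Proof. by move=> FG [a [ha [K h]]]; exists a; split=> //; exists K => x n; rewrite -FG. Qed.

Lemma approx_env m k (F : env k -> R) (r : env m -> env k) :
  approx F -> computable_env r -> approx (fun x => F (r x)).
Proof.
move=> [a [ha [K h]]] hr; exists (fun p : env m.+1 => a (r p.1, p.2)); split.
  apply: (comp_env ha); apply: cenv_pair (comp_v0 _).
  case: hr (cenv_1 m) => cs hcs [ds hds].
  exists [seq CComp c ds | c <- cs] => x.
  move: (env_seq (r x.1)) (hcs x.1) => ys; elim: cs ys {hcs} => [|c cs IH] ys hys.
    by inversion hys; apply: evs_nil.
  have [z [zs [-> hz hzs]]] := evals_cons_inv hys.
  by apply: evs_cons (IH _ hzs); apply: ev_comp (hds x) hz.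
by exists K => x n; apply: h.
Qed.

Lemma divn_approx (m b : nat) : `|(m %/ 2 ^ b)%:R - m%:R / 2 ^+ b| <= 1 :> R.
Proof.
have p : 0 < 2 ^+ b :> R by rewrite exprn_gt0.
have lt : (m %% 2 ^ b < 2 ^ b)%N by rewrite ltn_pmod // expn_gt0.
rewrite {2}(divn_eq m (2 ^ b)) natrD natrM natrX mulrDl mulfK ?gt_eqF //.
rewrite opprD addrA subrr sub0r normrN ger0_norm; last by rewrite divr_ge0 // ltW.
by rewrite ler_pdivrMr // mul1r -natrX ler_nat ltnW.
Qed.

Lemma ltr_natX b : b%:R <= 2 ^+ b :> R.
Proof. by rewrite -natrX ler_nat ltnW // ltn_expl. Qed.

(* The weights are absorbed by computing the terms with as many additional
   bits as their sum. *)
Lemma approx_sum k (l : env k -> nat) (w : env k -> nat -> nat) (f : env k -> nat -> R) :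
  computable l -> @computable k.+1 (fun p => w p.1 p.2) ->
  @approx k.+1 (fun p => f p.1 p.2) ->
  approx (fun x => \sum_(j < l x) (w x j)%:R * f x j).
Proof.
move=> hl hw [a [ha [K h]]].
pose B x := (\sum_(j < l x) w x j)%N.
have hB : computable B by apply: comp_sum.
exists (fun p : env k.+1 => (\sum_(j < l p.1) w p.1 j * a (p.1, nat_of_ord j, p.2 + B p.1)) %/ 2 ^ B p.1)%N.
split.
  comp_tac.
  - apply: (@comp_env k.+2 k.+1 (fun p => w p.1 p.2) (fun p => (p.1.1, p.2)) hw).
    exact: cenv_pair (cenv_11 _) (comp_v0 _).
  - apply: (@comp_env k.+2 k.+2 a (fun q => (q.1.1, q.2, q.1.2 + B q.1.1)%N) ha).
    apply: cenv_pair; first exact: cenv_pair (cenv_11 _) (comp_v0 _).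
    by apply: comp_add; [apply: comp_v1 | apply: (comp_env hB); apply: cenv_11].
exists K.+1 => x n /=; set S := (\sum_(j < _) _)%N.
have p : 0 < 2 ^+ B x :> R by rewrite exprn_gt0.
have e : `|S%:R / 2 ^+ B x - 2 ^+ n * \sum_(j < l x) (w x j)%:R * f x j| <= K%:R.
  have -> : S%:R / 2 ^+ B x - 2 ^+ n * \sum_(j < l x) (w x j)%:R * f x j =
    (\sum_(j < l x) (w x j)%:R * ((a (x, nat_of_ord j, n + B x)%N)%:R
       - 2 ^+ (n + B x) * f x j)) / 2 ^+ B x.
    apply: (@mulIf _ (2 ^+ B x)); first by rewrite gt_eqF.
    rewrite mulfVK ?gt_eqF // mulrBl mulfVK ?gt_eqF // natr_sum.
    rewrite -mulrA (mulrC (\sum_(j < _) _)) mulrA -exprD mulr_sumr -sumrB.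
    by apply: eq_bigr => j _; rewrite natrM mulrBr; congr (_ - _); ring.
  rewrite normrM normfV (gtr0_norm p) ler_pdivrMr //.
  apply: le_trans (ler_norm_sum _ _ _) _.
  apply: (@le_trans _ _ (\sum_(j < l x) (w x j)%:R * K%:R)).
    by apply: ler_sum => j _; rewrite normrM normr_nat ler_wpM2l.
  by rewrite -mulr_suml -natr_sum mulrC ler_wpM2l // ltr_natX.
apply: le_trans (ler_distD (S%:R / 2 ^+ B x) _ _) _.
by rewrite -(addn1 K) (natrD _ K) (addrC K%:R) lerD ?divn_approx.
Qed.

Lemma approx_add k (F G : env k -> R) : approx F -> approx G -> approx (fun x => F x + G x).
Proof.
move=> [a [ha [K hK]]] [b [hb [L hL]]].
exists (fun p => a p + b p)%N; split; first exact: comp_add.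
exists (K + L)%N => x n; have := hK x n; have := hL x n; rewrite !natrD !ler_norml.
by rewrite mulrDr; lra.
Qed.

(** Approximations are natural numbers, so only nonnegative differences can be represented. When the
    truncated subtraction returns 0 for a negative value, the true scaled difference is itself at
    most [K + L]. *)
Lemma approx_sub k (F G : env k -> R) : (forall x, G x <= F x) ->
  approx F -> approx G -> approx (fun x => F x - G x).
Proof.
move=> GF [a [ha [K hK]]] [b [hb [L hL]]].
exists (fun p => a p - b p)%N; split; first exact: comp_sub.
exists (K + L)%N => x n; have := hK x n; have := hL x n.
have := ler_wpM2l (exprn_ge0 n (ler0n R 2)) (GF x).
rewrite !ler_norml mulrBr natrD; case: (leqP (b (x, n)) (a (x, n))) => ba.
  by rewrite natrB //; lra.
move: (ba); rewrite -(ltr_nat R) => ba'.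
have -> : (a (x, n) - b (x, n) = 0)%N by lia.
have := ler0n R K; have := ler0n R L; lra.
Qed.

Lemma approx_nat k (w : env k -> nat) : computable w -> approx (fun x => (w x)%:R).
Proof.
move=> hw; exists (fun p : env k.+1 => 2 ^ p.2 * w p.1)%N; split; first by comp_tac.
by exists 0%N => x n; rewrite natrM natrX subrr normr0.
Qed.

Lemma approx_mul k (w : env k -> nat) (f : env k -> R) :
  computable w -> approx f -> approx (fun x => (w x)%:R * f x).
Proof.
move=> hw hf.
have := @approx_sum k (fun=> 1%N) (fun x _ => w x) (fun x _ => f x).
move=> /(_ (comp_const _ _) (comp_weak hw) (approx_env hf (cenv_1 _))).
by apply: approx_ext => x; rewrite big_ord1.
Qed.

Lemma approx_shift k (w : env k -> nat) (f : env k -> R) :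
  computable w -> approx f -> approx (fun x => f x / 2 ^+ w x).
Proof.
move=> hw [a [ha [K h]]].
exists (fun p : env k.+1 => a p %/ 2 ^ w p.1)%N; split; first by comp_tac.
exists K.+1 => x n /=.
have p : 1 <= 2 ^+ w x :> R by rewrite exprn_ege1 // ler1n.
have p0 : 0 < 2 ^+ w x :> R by rewrite exprn_gt0.
apply: le_trans (ler_distD ((a (x, n))%:R / 2 ^+ w x) _ _) _.
rewrite -(addn1 K) natrD (addrC K%:R) lerD ?divn_approx //.
rewrite mulrA -mulrBl normrM normfV (gtr0_norm p0) ler_pdivrMr //.
by apply: le_trans (h x n) _; rewrite ler_peMr.
Qed.

Lemma approx_lim k (F : env k -> R) (f : env k.+1 -> R) (C : nat) :
  approx f -> (forall x n, `|f (x, n) - F x| <= C%:R / 2 ^+ n) -> approx F.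
Proof.
move=> [a [ha [K h]]] hF; exists (fun p => a (p, p.2)); split.
  by apply: comp_subst => //; comp_tac.
exists (K + C)%N => x n; apply: le_trans (ler_distD (2 ^+ n * f (x, n)) _ _) _.
have p : 0 < 2 ^+ n :> R by rewrite exprn_gt0.
rewrite natrD lerD // -mulrBr normrM gtr0_norm //.
by rewrite -ler_pdivlMl // mulrC.
Qed.

Lemma approx_qv k (F : env k -> R) (p q : env k.+1 -> nat) :
  computable p -> computable q ->
  (forall x n, `|qv (p (x, n)) (q (x, n)) - F x| <= 2 ^- n) -> approx F.
Proof.
move=> hp hq h.
exists (fun z : env k.+1 => (2 ^ z.2 * p z) %/ (q z).+1)%N; split; first by comp_tac.
exists 2%N => x n /=; set P := p _; set Q := q _.
have Q0 : 0 < Q.+1%:R :> R by rewrite ltr0n.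
have p0 : 0 < 2 ^+ n :> R by rewrite exprn_gt0.
have h1 : `|2 ^+ n * qv P Q - 2 ^+ n * F x| <= 1.
  by rewrite -mulrBr normrM gtr0_norm // -ler_pdivlMl // mulr1 h.
have h2 : `|((2 ^ n * P) %/ Q.+1)%:R - 2 ^+ n * qv P Q| <= 1 :> R.
  rewrite /qv mulrA -natrX -natrM {2}(divn_eq (2 ^ n * P) Q.+1).
  rewrite natrD natrM mulrDl mulfK ?gt_eqF // opprD addrA subrr sub0r normrN.
  rewrite ger0_norm; last by rewrite divr_ge0 // ltW.
  rewrite ler_pdivrMr // mul1r ler_nat ltnW //.
  exact: ltn_pmod.
by apply: le_trans (ler_distD _ _ _) (lerD h2 h1).
Qed.

End Approximation.

(** * Measures on Cantor space *)

Section Cantor.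
Context {R : realType}.
Implicit Types (s : bits) (m : {measure set cantor -> \bar R}).

Lemma cylE s : cyl s = [set X | restr X (size s) = s].
Proof. by apply/seteqP; split=> X /is_prefixE. Qed.

Lemma measurable_cyl s : measurable (cyl s : set cantor).
Proof. by apply: sub_sigma_algebra; exists s. Qed.

Lemma measurable_restr n (P : set bits) : measurable ([set X | P (restr X n)] : set cantor).
Proof.
pose F e : set cantor := if `[< P (dec e) /\ size (dec e) = n >] then cyl (dec e) else set0.
have -> : [set X | P (restr X n)] = \bigcup_e F e.
  apply/seteqP; split=> [X PX|X [e _]].
    exists (enc (restr X n)) => //; rewrite /F encK size_restr.
    by rewrite asboolT //; apply: is_prefix_restr.
  by rewrite /F; case: asboolP => // -[Pe <-] /is_prefixE /= ->.
apply: bigcupT_measurable => e; rewrite /F; case: ifP => // _.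
exact: measurable_cyl.
Qed.

Lemma measurable_fun_restr n (f : bits -> \bar R) (D : set cantor) :
  @measurable_fun _ _ cantor (\bar R) D (fun X => f (restr X n)).
Proof.
by move=> mD A mA; apply: measurableI => //; apply: (measurable_restr n (f @^-1` A)).
Qed.

Lemma cyl_rcons s b : cyl (rcons s b) = cyl s `&` [set X | X (size s) = b].
Proof.
rewrite !cylE size_rcons; apply/seteqP; split=> X /=; rewrite restrS.
  by move/rcons_inj => [-> ->].
by case=> -> ->.
Qed.

Lemma cylU s : cyl s = cyl (rcons s false) `|` cyl (rcons s true).
Proof.
rewrite !cyl_rcons -setIUr; apply/seteqP; split=> [X sX|X []//].
by split=> //=; case: (X _); [right | left].
Qed.

Lemma cylI s : cyl (rcons s false) `&` cyl (rcons s true) = set0.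
Proof. by rewrite !cyl_rcons; apply/seteqP; split=> // X [[_ /= ->] []]. Qed.

Lemma additive_strs (phi : set cantor -> \bar R) n (E : set cantor) :
  (forall A B, measurable A -> measurable B -> A `&` B = set0 ->
    phi (A `|` B) = (phi A + phi B)%E) ->
  measurable E -> phi E = (\sum_(s <- strs n) phi (E `&` cyl s))%E.
Proof.
move=> add mE; elim: n => [|n IH].
  rewrite big_seq1; congr phi; apply/seteqP; split=> [X EX|X []//].
  by split.
rewrite big_strsS IH; apply: eq_bigr => s _.
have mEc b : measurable (E `&` cyl (rcons s b)).
  by apply: measurableI => //; apply: measurable_cyl.
by rewrite cylU setIUr add // setIACA cylI setI0.
Qed.

(** Stated for any additive set function because it is applied both to measures and to the integral
    of a test as a function of its domain. *)
Lemma additive_restr (phi : set cantor -> \bar R) n (b : pred bits) :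
  (forall A B, measurable A -> measurable B -> A `&` B = set0 ->
    phi (A `|` B) = (phi A + phi B)%E) -> phi set0 = 0%E ->
  phi [set X | b (restr X n)] = (\sum_(s <- strs n) if b s then phi (cyl s) else 0)%E.
Proof.
move=> add phi0; rewrite (additive_strs n add); last exact: (measurable_restr n (fun s => b s)).
apply: eq_big_seq => s /size_strs sn; case: ifPn => bs.
  congr phi; rewrite cylE sn; apply/seteqP; split=> X; first by case.
  by move=> /= Xs; split=> //=; rewrite Xs.
rewrite -phi0; congr phi; apply/seteqP; split=> // X [/= + /is_prefixE].
by rewrite sn => /[swap] ->; rewrite (negbTE bs).
Qed.

Definition wt (m : set cantor -> \bar R) s : R := fine (m (cyl s)).

Lemma wt_ge0 m s : 0 <= wt m s.
Proof. by apply: fine_ge0. Qed.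

Definition finite_cyl (m : set cantor -> \bar R) := forall s, m (cyl s) \is a fin_num.

Lemma wtE (m : set cantor -> \bar R) s : finite_cyl m -> m (cyl s) = (wt m s)%:E.
Proof. by move=> fm; rewrite fineK. Qed.

Lemma wt_rcons m s : finite_cyl m -> wt m s = wt m (rcons s false) + wt m (rcons s true).
Proof.
move=> fm; rewrite /wt {1}cylU measureU ?cylI //; try exact: measurable_cyl.
by rewrite fineD; [|apply: fm..].
Qed.

Lemma fine_restr m n (b : pred bits) : finite_cyl m ->
  m [set X | b (restr X n)] = (\sum_(s <- strs n) (b s)%:R * wt m s)%:E.
Proof.
move=> fm; rewrite (additive_restr n b) ?measure0 //; last exact: measureU.
rewrite -sumEFin; apply: eq_bigr => s _.
by case: (b s); rewrite ?mul0r // mul1r wtE.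
Qed.

Lemma finite_fin m (E : set cantor) : finite_cyl m -> measurable E -> m E \is a fin_num.
Proof.
move=> fm mE; rewrite ge0_fin_numE //; apply: le_lt_trans (_ : m (cyl [::]) < +oo)%E.
  by apply: le_measure; rewrite ?inE //; exact: measurable_cyl.
by rewrite -ge0_fin_numE.
Qed.

Lemma computable_measureP (m : set cantor -> \bar R) : computable_measure m <->
  finite_cyl m /\ @approx R 1 (fun x => wt m (dec x.2)).
Proof.
split=> [[p [q [/computable2P hp [/computable2P hq h]]]]|[fm [a [ha [K h]]]]].
  split; first by move=> s; have [r [-> _]] := h s 0%N.
  apply: (@approx_qv _ 1 _ (fun z => p z.1.2 z.2) (fun z => q z.1.2 z.2)).
  - by apply: (comp_app2 hp); [apply: comp_v1 | apply: comp_v0].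
  - by apply: (comp_app2 hq); [apply: comp_v1 | apply: comp_v0].
  - move=> [[] e] n /=; have [r []] := h (dec e) n.
    by rewrite /wt decK => ->.
(* With [K] additional bits, an error of [K] units becomes at most [2 ^- n], as [K <= 2 ^ K]. The
   predecessor offsets the successor in the denominator of [qv]. *)
exists (fun e n => a (tt, e, n + K)%N), (fun e n => (2 ^ (n + K)).-1)%N.
split; last split.
- apply/computable2P; apply: (comp_app2 (F := a)) => //; last by comp_tac.
  by comp_tac.
- by apply/computable2P; comp_tac.
move=> s n; exists (wt m s); split; first exact: wtE.
have := h (tt, enc s) (n + K)%N; rewrite encK /qv prednK ?expn_gt0 // => hn.
have p : 0 < 2 ^+ (n + K) :> R by rewrite exprn_gt0.
rewrite natrX -(ler_pM2l p) -{1}(gtr0_norm p) -normrM mulrBr mulrCA divff ?gt_eqF //.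
rewrite mulr1; apply: le_trans hn _.
by rewrite exprD mulrAC divff ?mul1r ?ltr_natX // gt_eqF // exprn_gt0.
Qed.

(* The extension is the image of Lebesgue measure under a quantile map. *)
Section Extension.
Variable g : bits -> R.
Hypothesis g_ge0 : forall s, 0 <= g s.
Hypothesis gD : forall s, g s = g (rcons s false) + g (rcons s true).

(** The total weight of the strings of the same length that precede [s] lexicographically: wherever
    [s] has a 1, the sibling on the left is skipped. *)
Let lo (s : bits) : R :=
  \sum_(j < size s | nth false s j) g (rcons (take j s) false).

Let lo_rcons s b : lo (rcons s b) = lo s + if b then g (rcons s false) else 0.
Proof.
rewrite /lo size_rcons [LHS]big_mkcond big_ord_recr /= nth_rcons ltnn eqxx.
rewrite [X in _ = X + _]big_mkcond /=; congr (_ + _).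
  apply: eq_bigr => i _; rewrite nth_rcons ltn_ord -(cats1 s b) takel_cat //.
  exact: ltnW.
by rewrite -(cats1 s b) take_size_cat.
Qed.

Let quantile_bits x : nat -> bits :=
  nat_rect (fun=> bits) [::] (fun _ s => rcons s (lo (rcons s true) <= x)).

Let quantile (x : R) : cantor :=
  fun n => lo (rcons (quantile_bits x n) true) <= x.

Let restr_quantile x n : restr (quantile x) n = quantile_bits x n.
Proof. by elim: n => // n IH; rewrite restrS IH. Qed.

Let quantile_cyl s b : quantile @^-1` cyl (rcons s b) =
  quantile @^-1` cyl s `&` (if b then `[lo (rcons s true), +oo[%classic else `]-oo, lo (rcons s true)[%classic).
Proof.
rewrite cyl_rcons preimage_setI; apply/seteqP; split=> x [] /[dup] /is_prefixE;
  rewrite restr_quantile => xs xs' h; split=> //; move: h; rewrite /preimage /= /quantile xs.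
- by case: b => /=; rewrite in_itv /= ?andbT // => /negbT; rewrite -ltNge.
- by case: b => /=; rewrite in_itv /= ?andbT // ltNge => /negbTE.
Qed.

Let measurable_quantile : measurable_fun [set: R] quantile.
Proof.
apply: (@measurability _ _ R cantor setT quantile (range cyl)) => //.
move=> _ [_ [s _ <-] <-]; rewrite setTI.
elim/last_ind: s => [|s b IH].
  by rewrite (_ : _ @^-1` _ = setT) //; apply/seteqP; split.
by rewrite quantile_cyl; apply: measurableI => //; case: b; apply: measurable_itv.
Qed.

Let D := `[0%R, g [::] [%classic : set R.
Let mD : measurable D. Proof. exact: measurable_itv. Qed.

(** Half-open intervals let the two children tile the interval of their parent exactly; the root
    receives [D]. *)
Let quantile_itv s : quantile @^-1` cyl s `&` D = `[lo s, lo s + g s[%classic.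
Proof.
elim/last_ind: s => [|s b IH].
  rewrite (_ : _ @^-1` _ = setT) ?setTI; last by apply/seteqP; split.
  by rewrite /lo big_ord0 add0r.
have g0 := g_ge0 (rcons s false); have g1 := g_ge0 (rcons s true).
rewrite quantile_cyl setIAC IH !lo_rcons gD; apply/seteqP; split=> x /=;
  case: b; rewrite /= !in_itv /=; lra.
Qed.

Lemma measure_extension_cyl :
  exists m : {measure set cantor -> \bar R}, forall s, m (cyl s) = (g s)%:E.
Proof.
exists (measure_function_pushforward__canonical__measure_function_Measure
  (mrestr (@lebesgue_measure R) mD) measurable_quantile) => s.
rewrite /= /pushforward /mrestr quantile_itv lebesgue_measure_itv /= lte_fin.
case: ltP => [_|le]; first by rewrite -EFinD addrAC subrr add0r.
by congr EFin; apply/eqP; rewrite eq_le g_ge0; lra.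
Qed.
End Extension.
End Cantor.

(** * Computable supermartingales on a computably random point *)

Section Supermartingale.
Context {R : realType}.

(** The supermartingale inequality for the ratio of [G] to a measure, cleared of the division and
    hence of the measure. *)
Definition superadditive (G : bits -> R) :=
  forall s, G (rcons s false) + G (rcons s true) <= G s.

Definition computable_weight (G : bits -> R) := @approx R 1 (fun x => G (dec x.2)).

Lemma dec_rcons e b : rcons (dec e) b = dec (e + 2 ^ len e * (1 + b)).
Proof. by apply: enc_inj; rewrite decK enc_rcons decK size_dec. Qed.

Lemma dec_take e k : (k <= len e)%N -> take k (dec e) = dec (tk k e).
Proof. by move=> ke; apply: enc_inj; rewrite decK -tk_enc ?decK // size_dec. Qed.

Lemma weight_comp k (G : bits -> R) (h : env k -> nat) : computable_weight G ->
  computable h -> @approx R k (fun x => G (dec (h x))).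
Proof.
move=> hG hh; apply: (approx_env (r := fun x => (tt, h x) : env 1) hG).
exact: cenv_pair (cenv_tt _) hh.
Qed.

Lemma weight_rcons G b : computable_weight G -> computable_weight (fun s => G (rcons s b)).
Proof.
move=> hG; apply: approx_ext (_ : approx (fun x : env 1 => G (dec (x.2 + 2 ^ len x.2 * (1 + b))%N))).
  by move=> x; rewrite dec_rcons.
apply: weight_comp => //; comp_tac.
by apply: comp_len; comp_tac.
Qed.

Lemma weight_add G H : computable_weight G -> computable_weight H ->
  computable_weight (fun s => G s + H s).
Proof. exact: approx_add. Qed.

Lemma weight_sub G H : (forall s, H s <= G s) ->
  computable_weight G -> computable_weight H -> computable_weight (fun s => G s - H s).
Proof. by move=> HG; apply: approx_sub => x; apply: HG. Qed.

Lemma comp_len0 : @computable 1 (fun x => len x.2).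
Proof. by apply: comp_len; comp_tac. Qed.

(** * Raising a superadditive weight to a computable measure *)

Section Domination.
Variable P : bits -> R.
Hypotheses (P_ge0 : forall s, 0 <= P s) (P_super : superadditive P).
Hypothesis cP : computable_weight P.

Let surplus s := P s - (P (rcons s false) + P (rcons s true)).

Let surplus_ge0 s : 0 <= surplus s.
Proof. by rewrite subr_ge0. Qed.

(* Every surplus is spread uniformly over the descendants. *)
Let kap s := P s + (\sum_(j < size s) (2 ^ j)%:R * surplus (take j s)) / 2 ^+ size s.

Let kap_rcons s b : kap (rcons s b) = P (rcons s b) +
  ((\sum_(j < size s) (2 ^ j)%:R * surplus (take j s)) / 2 ^+ size s + surplus s) / 2.
Proof.
rewrite /kap size_rcons big_ord_recr /= -cats1 take_size_cat //; congr (_ + _).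
have p : 2 ^+ size s != 0 :> R by rewrite expf_neq0.
rewrite exprS natrX (eq_bigr (fun j : 'I__ => (2 ^ j)%:R * surplus (take j s))); last first.
  by move=> j _; rewrite takel_cat // ltnW.
by field; rewrite p.
Qed.

Let kapD s : kap s = kap (rcons s false) + kap (rcons s true).
Proof. by rewrite !kap_rcons {1}/kap /surplus; lra. Qed.

Let P_kap s : P s <= kap s.
Proof.
by rewrite lerDl divr_ge0 // ?exprn_ge0 // sumr_ge0 // => j _; rewrite mulr_ge0.
Qed.

Let kap_computable : computable_weight kap.
Proof.
apply: approx_add => //.
apply: (@approx_ext _ 1 (fun x => (\sum_(j < len x.2)
    (2 ^ j)%:R * surplus (dec (tk j x.2))) / 2 ^+ len x.2)).
  move=> x; rewrite size_dec; congr (_ / _); apply: eq_bigr => j _.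
  by rewrite dec_take // ltnW.
apply: approx_shift; first exact: comp_len0.
apply: (@approx_sum _ 1 _ (fun _ j => 2 ^ j)%N (fun x j => surplus (dec (tk j x.2)))).
- exact: comp_len0.
- by comp_tac.
- apply: (@weight_comp 2 surplus); last by apply: comp_tk; comp_tac.
  by apply: weight_sub => //; apply: weight_add; apply: weight_rcons.
Qed.

(** Tests are bounded by computable measures, so a weight that is merely superadditive must first be
    made additive from above. *)
Lemma dominating_measure : exists k : {measure set cantor -> \bar R},
  computable_measure k /\ forall s, ((P s)%:E <= k (cyl s))%E.
Proof.
have kap_ge0 s : 0 <= kap s by apply: le_trans (P_kap s).
have [k hk] := measure_extension_cyl kap_ge0 kapD.
exists k; split; last by move=> s; rewrite hk lee_fin.
apply/computable_measureP; split; first by move=> s; rewrite hk.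
by apply: approx_ext kap_computable => x; rewrite /wt hk.
Qed.
End Domination.

(** * A computable superadditive weight along a random point *)

Section Bounded.
Variables (nu : {measure set cantor -> \bar R}) (G : bits -> R).
Hypotheses (G_ge0 : forall s, 0 <= G s) (G_super : superadditive G).
Hypotheses (cG : computable_weight G) (cnu : computable_measure nu).

Let fnu : finite_cyl nu := ((computable_measureP nu).1 cnu).1.
Let wnu : computable_weight (wt nu) := ((computable_measureP nu).1 cnu).2.

(* The summand [2 ^- size s] keeps [H] positive, so that finite precision suffices
   to compare it with multiples of [nu]. *)
Let H s := G s + 2 ^- size s.

Let H_gt s : 2 ^- size s <= H s. Proof. by rewrite lerDr. Qed.

Let H_gt0 s : 0 < H s.
Proof. by apply: lt_le_trans (H_gt s); rewrite invr_gt0 exprn_gt0. Qed.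

Let H_super : superadditive H.
Proof.
move=> s; have := G_super s; rewrite /H !size_rcons exprS invfM.
by set u := 2 ^- size s; lra.
Qed.

Let cH : computable_weight H.
Proof.
apply: weight_add => //.
apply: (@approx_ext _ 1 (fun x => 1%:R / 2 ^+ len x.2)).
  by move=> x; rewrite size_dec mul1r.
by apply: approx_shift; [apply: comp_len0 | apply: (@approx_nat _ 1 (fun=> 1%N)); comp_tac].
Qed.

(** The order of computable reals is undecidable, so the two alternatives overlap by a factor 2 and
    either answer is acceptable in between. *)
Let threshold_test : exists b : nat -> nat -> bool,
  @computable 2 (fun x => b x.1.2 x.2) /\ forall k s,
    if b k (enc s) then 2 ^+ k * wt nu s <= H s else H s <= 2 * 2 ^+ k * wt nu s.
Proof.
have [h [hh [K hK]]] := cH; have [v [hv [L hL]]] := wnu.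
(* At this precision [2 ^+ N * H s] is at least [8 * M * 2 ^+ k], while the rounding errors on both
   sides amount to at most [4 * M * 2 ^+ k], half of that. *)
pose M := (K + L)%N; pose n k e := (len e + k + 8 * M)%N.
exists (fun k e => 2 ^ k * (v (tt, e, n k e) + M) + M <= h (tt, e, n k e))%N.
have cn : @computable 2 (fun x => n x.1.2 x.2).
  by rewrite /n; comp_tac; apply: comp_len; comp_tac.
split.
  by comp_tac; apply: comp_app2 => //; comp_tac.
move=> k s; set N := n k (enc s).
have := hK (tt, enc s) N; have := hL (tt, enc s) N; rewrite /= encK.
set a := h _; set c := v _ => {}hL {}hK.
have p : 0 < 2 ^+ N :> R by rewrite exprn_gt0.
have p1 : 1 <= 2 ^+ k :> R by rewrite exprn_ege1 // ler1n.
have KM : K%:R <= M%:R :> R by rewrite ler_nat leq_addr.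
have LM : L%:R <= M%:R :> R by rewrite ler_nat leq_addl.
move: hL hK; rewrite !ler_norml => /andP[hL1 hL2] /andP[hK1 hK2].
case: ifP => [|/negbT]; rewrite -?ltnNge.
  rewrite -(ler_nat R) natrD natrM natrD natrX => le.
  rewrite -(ler_pM2l p) mulrCA.
  have : 2 ^+ k * (2 ^+ N * wt nu s) <= 2 ^+ k * (c%:R + M%:R) :> R.
    by rewrite ler_wpM2l //; lra.
  lra.
rewrite -(ltr_nat R) natrD natrM natrD natrX => lt.
have bd : 2 ^+ k * (8 * M%:R) <= 2 ^+ N * H s.
  apply: (@le_trans _ _ (2 ^+ N * 2 ^- size s)); last by rewrite ler_pM2l.
  rewrite /N /n len_enc -addnA addnC exprD mulfK ?expf_neq0 // exprD ler_pM2l ?exprn_gt0 //.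
  by rewrite -natrM ltr_natX.
rewrite -(ler_pM2l p).
have : 2 ^+ k * (c%:R + M%:R) <= 2 ^+ k * (2 ^+ N * wt nu s + 2 * M%:R) :> R.
  by rewrite ler_wpM2l //; lra.
have : M%:R <= 2 ^+ k * M%:R :> R by rewrite ler_peMl.
move: bd lt p1 hL1 hL2 hK1 hK2 KM LM.
move: (2 ^+ N) (2 ^+ k) (M%:R : R) (wt nu s) (H s) => pN pk m u v'.
lra.
Qed.

(** Along [Y] a level [lev] rises by one whenever [threshold_test] certifies [2 ^+ lev * nu <= H].
    The supremum of the levels is a test, hence finite at [Y]; once the level rests at [k], every
    later comparison gives [H <= 2 * 2 ^+ k * nu]. The term [2 ^- m] in the conclusion later yields
    that [nu] is positive on the prefixes of [Y], and that [B] is positive. *)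
Lemma random_bounded (Y : cantor) : computably_random nu Y ->
  exists B : R, forall m, G (restr Y m) + 2 ^- m <= B * wt nu (restr Y m).
Proof.
have [b [cb bP]] := threshold_test.
pose step s i acc := (acc + b acc (enc (take i.+1 s)))%N.
pose lev s := nat_rect (fun=> nat) 0%N (step s) (size s).
have lev_rcons s c : lev (rcons s c) = (lev s + b (lev s) (enc (rcons s c)))%N.
  have h j : (j <= size s)%N -> nat_rect (fun=> nat) 0%N (step (rcons s c)) j =
      nat_rect (fun=> nat) 0%N (step s) j.
    elim: j => //= j IH js; rewrite IH 1?ltnW // /step.
    by rewrite -cats1 takel_cat.
  rewrite {1}/lev size_rcons /= h // {1}/step.
  by rewrite -(size_rcons s c) take_size.
have clev : @computable 1 (fun x => lev (dec x.2)).
  have : @computable 1 (fun x => nat_rect (fun=> nat) 0%N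
      (fun i acc => acc + b acc (tk i.+1 x.2))%N (len x.2)).
    apply: (@comp_rec 1 _ (fun x i acc => acc + b acc (tk i.+1 x.2))%N).
    - by comp_tac.
    - comp_tac; apply: (@comp_app2 3 (fun x => b x.1.2 x.2)) => //; comp_tac.
      by apply: comp_len; comp_tac.
    - exact: comp_len0.
  apply: comp_ext => x; rewrite /lev size_dec.
  have h j : (j <= len x.2)%N -> nat_rect (fun=> nat) 0%N
      (fun i acc => acc + b acc (tk i.+1 x.2))%N j =
      nat_rect (fun=> nat) 0%N (step (dec x.2)) j.
    elim: j => //= j IH js; rewrite IH 1?ltnW // /step.
    by rewrite dec_take // decK.
  exact: h.
(* A rise of the level from [k] adds [wt nu] to the first summand and halves the second, which saves
   [H / 2 ^+ k]; the threshold says that the saving covers the cost. *)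
pose P s := (lev s)%:R * wt nu s + 2%:R * H s / 2 ^+ lev s.
have P_ge s : (lev s)%:R * wt nu s <= P s.
  by rewrite lerDl divr_ge0 ?exprn_ge0 // mulr_ge0 // ltW.
have P_ge0 s : 0 <= P s by apply: le_trans (P_ge s); rewrite mulr_ge0 // wt_ge0.
have P_step s c : P (rcons s c) <=
    (lev s)%:R * wt nu (rcons s c) + 2%:R * H (rcons s c) / 2 ^+ lev s.
  rewrite /P lev_rcons; have := bP (lev s) (rcons s c); case: (b _ _) => h; last by rewrite addn0.
  rewrite addn1 exprS -natr1 mulrDl mul1r -addrA lerD2l.
  have p : 0 < 2 ^+ lev s :> R by rewrite exprn_gt0.
  rewrite invfM mulrACA divff // mul1r -mulrA mulr_natl mulr2n lerD2r.
  by rewrite ler_pdivlMr // mulrC.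
have P_super : superadditive P.
  move=> s; apply: le_trans (lerD (P_step s false) (P_step s true)) _.
  rewrite addrACA -mulrDr -wt_rcons // lerD2l -mulrDl -mulrDr.
  by rewrite ler_pM2r ?invr_gt0 ?exprn_gt0 // ler_pM2l.
have cP : computable_weight P.
  apply: weight_add; first exact: (@approx_mul _ 1).
  apply: (@approx_shift _ 1 (fun x => lev (dec x.2))) => //.
  by apply: (@approx_mul _ 1 (fun=> 2)%N) => //; comp_tac.
have [kappa [ckappa Pk]] := dominating_measure P_ge0 P_super cP.
pose t (X : cantor) : \bar R := ereal_sup ([set 0%E] `|`
  [set (qv (lev (dec e)) 0 : R)%:E | e in [set e | is_prefix (dec e) X]]).
pose l (X : cantor) m : \bar R := (lev (restr X m))%:R%:E.
have tE X : t X = ereal_sup (range (l X)).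
  congr ereal_sup; apply/seteqP; split=> [_ [->|[e /is_prefixE eX <-]]|_ [m _ <-]].
  - by exists 0%N.
  - by exists (size (dec e)) => //; rewrite /l eX /qv divr1.
  - right; exists (enc (restr X m)); last by rewrite /l encK /qv divr1.
    by rewrite /= encK; apply: is_prefix_restr.
have l_nd X : {homo l X : m n / (m <= n)%N >-> (m <= n)%E}.
  apply: homo_leq => [x//|y x z|m]; first exact: le_trans.
  by rewrite /l restrS lev_rcons lee_fin ler_nat leq_addr.
have l_ge0 X m : (0 <= l X m)%E by rewrite lee_fin.
have ml m (D : set cantor) : measurable_fun D (fun X => l X m).
  exact: (@measurable_fun_restr R m (fun s => (lev s)%:R%:E)).
(* At depth [size s + n] the level is constant on cylinders, and there [lev * nu <= P <= kappa];
   additivity of [kappa] sums these bounds up to [cyl s]. *)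
have int_l n s : (\int[nu]_(X in cyl s) l X (size s + n)%N <= kappa (cyl s))%E.
  elim: n s => [|n IH] s.
    rewrite addn0; apply: le_trans (Pk s).
    rewrite (eq_integral (cst ((lev s)%:R%:E : \bar R))); last first.
      by move=> X; rewrite inE => /is_prefixE Xs; rewrite /l Xs.
    by rewrite integral_cst ?wtE //; [rewrite -EFinM lee_fin | apply: measurable_cyl].
  have -> : (\int[nu]_(X in cyl s) l X (size s + n.+1)%N =
      \int[nu]_(X in cyl (rcons s false)) l X (size s + n.+1)%N +
      \int[nu]_(X in cyl (rcons s true)) l X (size s + n.+1)%N)%E.
    rewrite [X in (\int[_]_(_ in X) _)%E]cylU.
    apply: ge0_integral_setU => //; try exact: measurable_cyl.
    exact/disj_set2P/cylI.
  rewrite [X in (_ <= kappa X)%E]cylU measureU; [|exact: measurable_cyl..|exact: cylI].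
  by have := leeD (IH (rcons s false)) (IH (rcons s true)); rewrite !size_rcons -!addSnnS.
move=> rY; have tY : (t Y < +oo)%E.
  apply: (rY t kappa) => //.
    exists dec, (fun e => lev (dec e)), (fun=> 0%N); split.
      by apply/computable1P; apply: comp_ext (comp_v0 0) => x; rewrite decK.
    by split; [apply/computable1P | split; first by apply/computable1P; comp_tac].
  move=> s.
  have -> : t = fun X => limn (l X).
    apply/funext => X; rewrite tE; apply/esym/cvg_lim => //.
    exact: ereal_nondecreasing_cvgn.
  have := @monotone_convergence _ _ R nu (cyl s) (measurable_cyl s) (fun n X => l X n)
    (fun n => ml n _) (fun n X _ => l_ge0 X n) (fun X _ => @l_nd X).
  move=> ->; apply: lime_le.
    apply: ereal_nondecreasing_is_cvgn => m n mn; apply: ge0_le_integral => //.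
      exact: measurable_cyl.
    by move=> X _; apply: l_nd.
  apply: nearW => m; apply: le_trans (int_l m s).
  apply: ge0_le_integral => //; first exact: measurable_cyl.
  by move=> X _; apply: l_nd; rewrite leq_addl.
have l_t m : (l Y m <= t Y)%E by rewrite tE; apply: ereal_sup_ubound; exists m.
pose atlev v := `[< exists m, lev (restr Y m) = v >].
have lev_ex : exists v, atlev v by exists 0%N; apply/asboolP; exists 0%N.
have [V lev_le] : exists V, forall v, atlev v -> (v <= V)%N.
  case: (t Y) tY l_t => [r _ lr|//|_ /(_ 0%N)//].
  exists (Num.bound r) => _ /asboolP[m <-]; rewrite -(ler_nat R).
  have := lr m; rewrite lee_fin => /le_trans; apply; apply/ltW/archi_boundP.
  by have := lr 0%N; rewrite lee_fin; apply: le_trans.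
have [k /asboolP[m0 m0k] kmax] := ex_maxnP lev_ex lev_le.
have levk m : (m0 <= m)%N -> lev (restr Y m) = k.
  move=> m0m; apply/eqP; rewrite eqn_leq kmax; last by apply/asboolP; exists m.
  by rewrite -m0k -(ler_nat R) -lee_fin; apply: l_nd.
(* Beyond [m0] the level stays [k], so the comparison made at that level when reading the last bit
   had the negative outcome. *)
have H_nu m : (m0 < m)%N -> H (restr Y m) <= 2 * 2 ^+ k * wt nu (restr Y m).
  case: m => // m m0m; have := bP k (restr Y m.+1).
  have := levk m.+1 (leqW m0m); rewrite {1}restrS lev_rcons (levk m m0m) -restrS.
  by case: (b _ _) => //; lia.
have le_restr (F : bits -> R) m n : (forall s c, F (rcons s c) <= F s) -> (m <= n)%N ->
    F (restr Y n) <= F (restr Y m).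
  move=> Fs; elim: n => [|n IH]; first by rewrite leqn0 => /eqP->.
  rewrite leq_eqVlt => /predU1P[->//|/IH]; rewrite restrS; exact: le_trans.
have H_le s c : H (rcons s c) <= H s.
  by have := H_super s; have := H_gt0 (rcons s false); have := H_gt0 (rcons s true); case: c; lra.
have nu_le s c : wt nu (rcons s c) <= wt nu s.
  rewrite (wt_rcons s fnu); have := wt_ge0 nu (rcons s false).
  by have := wt_ge0 nu (rcons s true); case: c; lra.
have p : 0 < 2 * 2 ^+ k :> R by rewrite mulr_gt0 ?exprn_gt0.
have nu1 : 0 < wt nu (restr Y m0.+1).
  by rewrite -(pmulr_rgt0 _ p); apply: lt_le_trans (H_nu _ _).
(* The first summand handles [m > m0]. For the finitely many other [m], [H] is at most its value at
   the root and [nu] at least its positive value at [m0.+1]. *)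
exists (2 * 2 ^+ k + H [::] / wt nu (restr Y m0.+1)) => m.
have -> : G (restr Y m) + 2 ^- m = H (restr Y m) by rewrite /H size_restr.
rewrite mulrDl; have [mm0|mm0] := ltnP m0 m.
  apply: le_trans (H_nu m mm0) _; rewrite lerDl mulr_ge0 ?wt_ge0 //.
  by rewrite divr_ge0 ?ltW.
apply: (@le_trans _ _ (H [::])); first exact: (le_restr H 0%N m).
apply: (@le_trans _ _ (H [::] / wt nu (restr Y m0.+1) * wt nu (restr Y m))).
  rewrite mulrAC ler_pdivlMr // ler_pM2l //.
  exact: (le_restr (wt nu) m m0.+1 nu_le (leqW mm0)).
by rewrite lerDr mulr_ge0 ?wt_ge0 // ltW.
Qed.
End Bounded.
End Supermartingale.

(** * The stages at which the map has produced enough output *)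

Section FiniteMeasure.
Context {R : realType}.
Variable m : {measure set cantor -> \bar R}.
Hypothesis fm : finite_cyl m.

Definition rm (A : set cantor) : R := fine (m A).

Lemma rmE A : measurable A -> m A = (rm A)%:E.
Proof. by move=> mA; rewrite fineK // finite_fin. Qed.

Lemma rm_ge0 A : 0 <= rm A.
Proof. exact: fine_ge0. Qed.

Lemma rm_le A B : measurable A -> measurable B -> A `<=` B -> rm A <= rm B.
Proof.
by move=> mA mB AB; rewrite -lee_fin -!rmE //; apply: le_measure; rewrite ?inE.
Qed.

Lemma rmU A B : measurable A -> measurable B -> A `&` B = set0 -> rm (A `|` B) = rm A + rm B.
Proof.
move=> mA mB AB; apply: EFin_inj; rewrite EFinD -!rmE ?measureU //.
exact: measurableU.
Qed.

Lemma rmU_le A B : measurable A -> measurable B -> rm (A `|` B) <= rm A + rm B.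
Proof.
move=> mA mB; have mBA : measurable (B `\` A) by apply: measurableD.
have -> : A `|` B = A `|` (B `\` A).
  apply/seteqP; split=> X; last by case=> [AX|[BX _]]; [left | right].
  by have [AX|nAX] := pselect (A X); [left | case=> // BX; right].
rewrite rmU //; last by apply/seteqP; split=> // X [AX []].
by rewrite lerD2l; apply: rm_le => // X [].
Qed.

Lemma rm_disjoint_le A B C : measurable A -> measurable B -> measurable C ->
  A `&` B = set0 -> A `<=` C -> B `<=` C -> rm A + rm B <= rm C.
Proof.
move=> mA mB mC AB AC BC; rewrite -rmU //; apply: rm_le => //.
  exact: measurableU.
by move=> X [/AC|/BC].
Qed.

Lemma rm_restr n (b : pred bits) :
  rm [set X | b (restr X n)] = \sum_(s <- strs n) (b s)%:R * wt m s.
Proof. by rewrite /rm fine_restr. Qed.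
End FiniteMeasure.

Lemma approx_strs {R : realType} k (W : bits -> R) (L : env k -> nat) (w : env k -> nat -> nat) :
  computable_weight W -> computable L -> @computable k.+1 (fun p => w p.1 p.2) ->
  approx (fun x => \sum_(s <- strs (L x)) (w x (enc s))%:R * W s).
Proof.
move=> hW hL hw.
apply: (@approx_ext _ _ (fun x => \sum_(j < 2 ^ L x)
    (w x (j + (2 ^ L x).-1)%N)%:R * W (dec (j + (2 ^ L x).-1)%N))).
  move=> x; rewrite (big_strs_enc (L x) (fun e => (w x e)%:R * W (dec e))).
  by apply: eq_bigr => s _; rewrite encK.
have cj : @computable k.+1 (fun p => (p.2 + (2 ^ L p.1).-1)%N) by comp_tac.
apply: (@approx_sum _ k _ (fun x j => w x (j + (2 ^ L x).-1)%N)
  (fun x j => W (dec (j + (2 ^ L x).-1)%N))).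
- by comp_tac.
- apply: (@comp_env k.+1 k.+1 (fun p => w p.1 p.2)
    (fun p => (p.1, p.2 + (2 ^ L p.1).-1)%N)) => //.
  exact: cenv_pair (cenv_1 _) cj.
- exact: weight_comp cj.
Qed.

Section Map.
Context {R : realType}.
Variables (mu : {measure set cantor -> \bar R}) (T : cantor -> option cantor).
Variables (phi : bits -> bits) (g : nat -> nat).
Hypothesis cg : computable1 g.
Hypothesis g_enc : forall s, g (enc s) = enc (phi s).
Hypothesis phi_mono : forall s t, sprefix s t -> sprefix (phi s) (phi t).
Hypothesis TP : forall X Y : cantor, T X = Some Y <->
  ((forall n, is_prefix (phi (restr X n)) Y) /\
   (forall m, exists n, (m <= size (phi (restr X n)))%N)).
Hypothesis cmu : computable_measure mu.
Hypothesis mu1 : mu setT = 1%E.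
Hypothesis mu_dom : mu [set X | T X != None] = 1%E.

Let fmu : finite_cyl mu := ((computable_measureP mu).1 cmu).1.
Let wmu : computable_weight (wt mu) := ((computable_measureP mu).1 cmu).2.

Let phi_restr X m n : (m <= n)%N -> sprefix (phi (restr X m)) (phi (restr X n)).
Proof. by move=> mn; apply/phi_mono/sprefix_restr. Qed.

Let size_phi X m n : (m <= n)%N -> (size (phi (restr X m)) <= size (phi (restr X n)))%N.
Proof. by move=> mn; apply/sprefix_size/phi_restr. Qed.

Lemma sprefix_comparable s t u : sprefix s u -> sprefix t u -> (size s <= size t)%N ->
  sprefix s t.
Proof.
rewrite /sprefix => /eqP su /eqP tu st; rewrite {1}su {1}tu.
by rewrite take_takel.
Qed.

Lemma map_defined X : (exists Y, T X = Some Y) <->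
  (forall m, exists n, (m <= size (phi (restr X n)))%N).
Proof.
split=> [[Y /TP[]]//|ex].
pose n m := sval (cid (ex m)).
have nP m : (m <= size (phi (restr X (n m))))%N by rewrite /n; case: cid.
exists (fun i => nth false (phi (restr X (n i.+1))) i); apply/TP; split=> // k i ik.
have [le|/ltnW le] := leqP k (n i.+1).
  have /eqP {1}-> := phi_restr X le.
  by rewrite nth_take.
by have /eqP -> := phi_restr X le; rewrite nth_take.
Qed.

Definition dom := [set X | T X != None].

Lemma domE : dom = \bigcap_m \bigcup_n [set X : cantor | (m <= size (phi (restr X n)))%N].
Proof.
have dP X : dom X <-> exists Y, T X = Some Y.
  rewrite /dom /=; case: (T X) => [Y|]; first by split=> // _; exists Y.
  by split=> // -[].
apply/seteqP; split=> X.
  by move=> /dP /map_defined h m _; have [n] := h m; exists n.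
by move=> h; apply/dP/map_defined => m; have [n _] := h m I; exists n.
Qed.

Lemma measurable_restr_pred n (b : pred bits) :
  measurable ([set X | b (restr X n)] : set cantor).
Proof. exact: (measurable_restr n (fun s => b s)). Qed.

Lemma measurable_dom : measurable (dom : set cantor).
Proof.
rewrite domE; apply: bigcapT_measurable => m; apply: bigcupT_measurable => n.
exact: (measurable_restr n (fun s => (m <= size (phi s))%N)).
Qed.

Definition preim s := [set X : cantor | exists Y, T X = Some Y /\ cyl s Y].

Lemma preimE s : preim s = dom `&` \bigcup_n [set X : cantor | sprefix s (phi (restr X n))].
Proof.
apply/seteqP; split=> X.
  move=> [Y [TXY sY]]; split; first by rewrite /dom /= TXY.
  have [pY uY] := (TP X Y).1 TXY; have [n sn] := uY (size s).
  by exists n => //=; apply/(is_prefix_sprefix sn (pY n)).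
rewrite /dom /=; case E: (T X) => [Y|] [] // _ [n _ /= sn]; exists Y; split=> //.
have [pY _] := (TP X Y).1 E.
by apply/(is_prefix_sprefix (sprefix_size sn) (pY n)).
Qed.

Lemma measurable_preim s : measurable (preim s).
Proof.
rewrite preimE; apply: measurableI; first exact: measurable_dom.
by apply: bigcupT_measurable => n; apply: (measurable_restr_pred n (fun t => sprefix s (phi t))).
Qed.

Lemma rm_domC : rm mu (~` dom) = 0.
Proof.
have mD := measurable_dom; have mDC := measurableC mD.
have := rmU fmu mD mDC (setICr dom); rewrite setUCr.
have -> : rm mu setT = 1 by rewrite /rm mu1.
have -> : rm mu dom = 1 by rewrite /rm mu_dom.
by lra.
Qed.

Lemma rm_le_dom A B : measurable A -> measurable B -> A `&` dom `<=` B ->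
  rm mu A <= rm mu B.
Proof.
move=> mA mB AB; have mDC := measurableC measurable_dom.
rewrite -[leRHS]addr0 -rm_domC; apply: le_trans (rmU_le fmu mB mDC).
apply: rm_le => //; first exact: measurableU.
by move=> X AX; have [DX|] := pselect (dom X); [left; apply: AB | right].
Qed.

(** These sets decrease in [s], and a point in all of them lies outside [dom], a null set. *)
Lemma small_cvg N : (fun s => mu [set X : cantor | (size (phi (restr X s)) < N)%N]) @ \oo --> 0%E.
Proof.
pose F s : set cantor := [set X | (size (phi (restr X s)) < N)%N].
have mF s : measurable (F s) by apply: (measurable_restr_pred s (fun t => size (phi t) < N)%N).
have mIF : measurable (\bigcap_s F s) by apply: bigcapT_measurable.
have <- : mu (\bigcap_s F s) = 0%E.
  rewrite rmE //; congr EFin; apply/eqP; rewrite eq_le rm_ge0 andbT -rm_domC.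
  apply: rm_le => //; first exact: measurableC measurable_dom.
  move=> X FX; rewrite /= domE => /(_ N I)[n _ /=].
  by have := FX n I; rewrite /F /=; lia.
apply: nonincreasing_cvg_mu => //.
  by have := ltry (rm mu (F 0%N)); rewrite -rmE.
move=> m n mn; apply/subsetPset => X; rewrite /F /=.
by have := size_phi X mn; lia.
Qed.

Lemma stages : exists st : nat -> nat, [/\ @computable 1 (fun x => st x.2),
  {homo st : m n / (m <= n)%N} &
  forall n, rm mu [set X : cantor | (size (phi (restr X (st n))) < n)%N] <= 4 ^- n].
Proof.
have : @approx R 2 (fun x => \sum_(s <- strs x.2) (len (g (enc s)) < x.1.2)%N%:R * wt mu s).
  apply: (@approx_strs R 2 (wt mu) _ (fun x e => (len (g e) < x.1.2)%N)) => //.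
    by comp_tac.
  comp_tac; apply: comp_len; apply: (@comp_app1 3 (fun x => g x.2)); last by comp_tac.
  exact/computable1P.
move=> [a [ca [K hK]]].
(* A stage is accepted when its approximation is at most [K.+1]; the true value is then at most
   [(2 * K + 1) / 2 ^+ n N], and [2 ^+ n N * 4 ^- N = 2 ^+ (2 * K + 1)] dominates the numerator.
   True values below [2 ^- n N] are always accepted, so the search ends. *)
pose n N := (2 * N + (2 * K + 1))%N.
have hE N s : \sum_(t <- strs s) (len (g (enc t)) < N)%N%:R * wt mu t =
    rm mu [set X : cantor | (size (phi (restr X s)) < N)%N].
  rewrite (rm_restr fmu s (fun t => size (phi t) < N)%N); apply: eq_bigr => t _.
  by rewrite g_enc len_enc.
have [] := @comp_min 1 (fun x s => ~~ (a (x, s, n x.2) <= K.+1)%N : nat).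
- have cn : @computable 2 (fun x => n x.1.2).
    by apply: comp_add; [apply: comp_mul|]; comp_tac.
  by comp_tac; apply: (comp_env ca); apply: cenv_pair (cenv_id _) cn.
- move=> [[] N]; have := small_cvg N => /fine_cvgP[_] /cvgrPdist_lt.
  move=> /(_ (2 ^- n N)); rewrite invr_gt0 exprn_gt0 // => /(_ isT)[s _ /(_ s (leqnn s)) /=].
  rewrite sub0r normrN ger0_norm ?rm_ge0 // => small; exists s.
  have := hK (tt, N, s) (n N); rewrite /= hE ler_norml => /andP[_ h].
  suff -> : (a (tt, N, s, n N) <= K.+1)%N by [].
  rewrite -(ler_nat R) -addn1 natrD.
  suff : 2 ^+ n N * rm mu [set X : cantor | (size (phi (restr X s)) < N)%N] <= 1 by lra.
  by rewrite -ler_pdivlMl ?exprn_gt0 // mulr1 ltW.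
move=> st0 cst0 st0P.
have st0_le N : rm mu [set X : cantor | (size (phi (restr X (st0 (tt, N)))) < N)%N] <= 4 ^- N.
  have := st0P (tt, N) => /= /eqP; rewrite eqb0 negbK -(ler_nat R) -addn1 natrD => h.
  have := hK (tt, N, st0 (tt, N)) (n N); rewrite /= hE ler_norml => /andP[h' _].
  rewrite -(@ler_pM2l _ (2 ^+ n N)) ?exprn_gt0 //.
  have -> : 2 ^+ n N * 4 ^- N = 2 ^+ (2 * K + 1) :> R.
    rewrite /n exprD exprM (_ : 2 ^+ 2 = 4); last by rewrite expr2 -natrM.
    by rewrite mulrAC divff ?mul1r // expf_neq0.
  have := @ltr_natX R (2 * K + 1); rewrite natrD natrM; lra.
(* Partial sums make the stages monotone, and a later stage only shrinks the exceptional set.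
   Monotonicity lets one string of length [st M] decide every [C n] with [n <= M]. *)
exists (fun N => \sum_(i < N.+1) st0 (tt, nat_of_ord i))%N; split.
- comp_tac; apply: (@comp_app1 2 st0) => //; comp_tac.
- apply: homo_leq => [//|y x z|m]; first exact: leq_trans.
  by rewrite [leqRHS]big_ord_recr leq_addr.
- move=> N; apply: le_trans (st0_le N); apply: rm_le => //.
  + exact: (measurable_restr_pred _ (fun t => size (phi t) < N)%N).
  + exact: (measurable_restr_pred _ (fun t => size (phi t) < N)%N).
  + move=> X /=; apply: leq_ltn_trans; apply: size_phi.
    by rewrite big_ord_recr leq_addl.
Qed.

(** * Exceptional sets and weights at computable stages *)

Section Stages.
Variable st : nat -> nat.
Hypothesis cst : @computable 1 (fun x => st x.2).
Hypothesis st_homo : {homo st : m n / (m <= n)%N}.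

Definition C n := [set X : cantor | (size (phi (restr X (st n))) < n)%N].
Definition Q n s := [set X : cantor | sprefix s (phi (restr X (st n)))].

Hypothesis C_small : forall n, rm mu (C n) <= 4 ^- n.

Lemma measurable_C n : measurable (C n).
Proof. exact: (measurable_restr_pred _ (fun t => size (phi t) < n)%N). Qed.

Lemma measurable_Q n s : measurable (Q n s).
Proof. exact: (measurable_restr_pred _ (fun t => sprefix s (phi t))). Qed.

(** Outputs along one point are comparable, so whether [s] begins an output depends only on that
    output being long enough. *)
Lemma phi_prefix X k n s : sprefix s (phi (restr X k)) ->
  (size s <= size (phi (restr X n)))%N -> sprefix s (phi (restr X n)).
Proof.
move=> sk sn; have [kn|/ltnW nk] := leqP k n.
  exact: sprefix_trans sk (phi_restr X kn).
exact: sprefix_comparable sk (phi_restr X nk) sn.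
Qed.

Lemma preim_sub n s : (size s <= n)%N -> preim s `<=` Q n s `|` C n.
Proof.
rewrite preimE => sn X [_ [k _ /= sk]].
have [nX|Xn] := leqP n (size (phi (restr X (st n)))); last by right.
by left; apply: phi_prefix sk _; apply: leq_trans nX.
Qed.

Lemma Q_preim n s : Q n s `&` dom `<=` preim s.
Proof. by rewrite preimE => X [sX DX]; split=> //; exists (st n). Qed.

Lemma computable_pref_g k (d e : env k -> nat) : computable d -> computable e ->
  computable (fun x => pref (d x) (g (e x)) : nat).
Proof.
move=> hd he; apply: comp_pref => //.
by apply: (@comp_app1 k (fun x => g x.2)) => //; apply/computable1P.
Qed.

Lemma comp_st k (e : env k -> nat) : computable e -> computable (fun x => st (e x)).
Proof. exact: (@comp_app1 k (fun x => st x.2)). Qed.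

Lemma pow24 n : 2 ^+ n * 4 ^- n = 2 ^- n :> R.
Proof.
have -> : 4 ^- n = 2 ^- n * 2 ^- n :> R by rewrite -invfM -exprMn -natrM.
by rewrite mulrA divff ?mul1r // expf_neq0.
Qed.

Lemma computable_pushforward (nu : {measure set cantor -> \bar R}) :
  is_pushforward mu nu T ->
  computable_measure nu /\ forall s, wt nu s = rm mu (preim s).
Proof.
move=> nuE; have wtE' s : wt nu s = rm mu (preim s).
  by rewrite /wt nuE //; apply: measurable_cyl.
split=> //; apply/computable_measureP; split.
  by move=> s; rewrite nuE; [apply: finite_fin => //; apply: measurable_preim | apply: measurable_cyl].
(* Up to a null set, [Q N s] lies in [preim s] and misses at most a part of [C N], provided
   [size s <= N]. Both this and the error bound [4 ^- N <= 2 ^- n] dictate [N = n + size s]. *)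
apply: (@approx_lim R 1 _ (fun x : env 2 => \sum_(s <- strs (st (x.2 + len x.1.2)))
    (pref x.1.2 (g (enc s)))%:R * wt mu s) 1).
  apply: (@approx_strs R 2 (wt mu) _ (fun x e => pref x.1.2 (g e))) => //.
    by apply: comp_st; apply: comp_add; [comp_tac | apply: comp_len; comp_tac].
  by apply: computable_pref_g; comp_tac.
move=> [[] e] n /=; set s := dec e; set N := (n + len e)%N.
have -> : \sum_(t <- strs (st N)) (pref e (g (enc t)))%:R * wt mu t = rm mu (Q N s).
  rewrite (rm_restr fmu (st N) (fun t => sprefix s (phi t))); apply: eq_bigr => t _.
  by rewrite g_enc -pref_enc decK.
have mQ := measurable_Q N s; have mP := measurable_preim s; have mC := measurable_C N.
have h1 : rm mu (Q N s) <= rm mu (preim s) by apply: rm_le_dom => //; apply: Q_preim.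
have h2 : rm mu (preim s) <= rm mu (Q N s) + rm mu (C N).
  apply: le_trans (rmU_le fmu mQ mC); apply: rm_le => //; first exact: measurableU.
  by apply: preim_sub; rewrite size_dec leq_addl.
have h3 : 4 ^- N <= 2 ^- n :> R.
  rewrite lef_pV2 ?posrE ?exprn_gt0 // -!natrX ler_nat.
  have -> : (4 ^ N = 2 ^ (2 * N))%N by rewrite expnM.
  by rewrite leq_exp2l // /N; lia.
by rewrite wtE' mul1r; have := C_small N; rewrite ler_norml; lra.
Qed.

Let lvl (s : bits) := (2 * size s + 3)%N.

(** A finite-stage version of the sum of [2 ^+ n * mu (C n)] restricted to [preim s]. The term
    [4 ^- size s] is a credit that pays for replacing [preim s] by [Q] and for cutting the sum
    off. *)
Definition theta s : R :=
  \sum_(n < (lvl s).+1) 2 ^+ n * rm mu (C n `&` Q (lvl s) s) + 4 ^- size s.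

Let F M s : R := \sum_(n < M) 2 ^+ n * rm mu (C n `&` preim s).

Let F_ge0 M s : 0 <= F M s.
Proof. by apply: sumr_ge0 => n _; rewrite mulr_ge0 ?exprn_ge0 // rm_ge0. Qed.

Let F_le M d s : F M s <= F (M + d) s.
Proof.
elim: d => [|d IH]; first by rewrite addn0.
apply: le_trans IH _; rewrite addnS /F [leRHS]big_ord_recr lerDl.
by rewrite mulr_ge0 ?exprn_ge0 // rm_ge0.
Qed.

Let mCP n s : measurable (C n `&` preim s).
Proof. by apply: measurableI; [apply: measurable_C | apply: measurable_preim]. Qed.

Let mCQ n m s : measurable (C n `&` Q m s).
Proof. by apply: measurableI; [apply: measurable_C | apply: measurable_Q]. Qed.

Let p2 n : 0 < 2 ^+ n :> R. Proof. by rewrite exprn_gt0. Qed.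

(** With [N = lvl s], passing from [preim s] to [Q N s] costs at most [2 ^+ n * 4 ^- N] in the
    [n]-th term, less than [2 * 2 ^- N] for all [n <= N]; the tail costs at most [2 ^- N]. Since
    [lvl] is chosen with [2 ^- N = 4 ^- size s / 8], three eighths of the credit are spent. *)
Lemma sum_small M s : F M s + 5 / 8 * 4 ^- size s <= theta s.
Proof.
set N := lvl s; pose A := \sum_(n < N.+1) 2 ^+ n * rm mu (C n `&` Q N s).
have e8 : 2 ^- N = 4 ^- size s / 8 :> R.
  rewrite /N /lvl exprD exprM invfM (_ : 2 ^+ 2 = 4); last by rewrite expr2 -natrM.
  by congr (_ * _^-1); rewrite !exprS expr0; lra.
suff h : F (N.+1 + M) s <= A + 3 * 2 ^- N.
  have := F_le M N.+1 s; rewrite addnC; rewrite /theta -/N -/A; lra.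
have base k : (k <= N.+1)%N ->
    F k s <= \sum_(n < k) 2 ^+ n * rm mu (C n `&` Q N s) + (2 ^+ k - 1) * 4 ^- N.
  elim: k => [|k IH] kN; first by rewrite /F !big_ord0 expr0 subrr mul0r addr0.
  rewrite /F !big_ord_recr /=; have := IH (ltnW kN); rewrite -/(F k s).
  have : 2 ^+ k * rm mu (C k `&` preim s) <= 2 ^+ k * (rm mu (C k `&` Q N s) + 4 ^- N).
    rewrite ler_pM2l //; apply: le_trans (lerD (lexx _) (C_small N)).
    apply: le_trans (rmU_le fmu (mCQ k N s) (measurable_C N)).
    apply: rm_le => //; first by apply: measurableU => //; apply: measurable_C.
    move=> X [CX /(@preim_sub N s)]; case=> [|QX|]; first by rewrite /N /lvl; lia.
      by left.
    by right.
  by rewrite exprS; lra.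
elim: M => [|M IH]; last first.
  (* The subtracted power leaves room for the rest of the geometric tail, so that the induction
     closes. *)
  have tl d : F (N.+1 + d) s <= A + 3 * 2 ^- N - 2 ^- (N + d).
    elim: d => [|d IHd].
      rewrite addn0 addn0; have := base N.+1 (leqnn _); rewrite -/A exprS.
      have -> : (2 * 2 ^+ N - 1) * 4 ^- N = 2 * 2 ^- N - 4 ^- N :> R.
        by rewrite mulrBl mul1r -mulrA pow24.
      have : 0 <= 4 ^- N :> R by rewrite invr_ge0 exprn_ge0.
      lra.
    rewrite addnS /F big_ord_recr /= -/(F _ s).
    have : 2 ^+ (N.+1 + d) * rm mu (C (N.+1 + d) `&` preim s) <= 2 ^- (N.+1 + d).
      apply: (@le_trans _ _ (2 ^+ (N.+1 + d) * 4 ^- (N.+1 + d))).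
        rewrite ler_pM2l //; apply: le_trans (C_small _).
        by apply: rm_le => //; apply: measurable_C.
      by rewrite pow24.
    by rewrite addnS addSn exprS invfM; move: IHd; lra.
  apply: le_trans (tl M.+1) _.
  by have : 0 <= 2 ^- (N + M.+1) :> R by [rewrite invr_ge0 ltW]; lra.
rewrite addn0; apply: le_trans (base N.+1 (leqnn _)) _; rewrite lerD2l exprS.
rewrite mulrBl mul1r -mulrA pow24.
have : 0 <= 4 ^- N :> R by rewrite invr_ge0 exprn_ge0.
have : 0 <= 2 ^- N :> R by rewrite invr_ge0 ltW.
lra.
Qed.

Lemma theta_ge0 s : 0 <= theta s.
Proof.
rewrite addr_ge0 ?invr_ge0 ?exprn_ge0 //.
by apply: sumr_ge0 => n _; rewrite mulr_ge0 ?exprn_ge0 // rm_ge0.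
Qed.

Lemma sprefix_split s u : sprefix (rcons s false) u -> sprefix (rcons s true) u -> False.
Proof. by rewrite /sprefix !size_rcons => /eqP <- /eqP /rcons_inj[]. Qed.

Lemma preim_rcons s b : preim (rcons s b) `<=` preim s.
Proof.
rewrite !preimE => X [DX [n _ /= sX]]; split=> //; exists n => //=.
by apply: sprefix_trans sX; apply: sprefix_rcons.
Qed.

Lemma preim_disjoint s : preim (rcons s false) `&` preim (rcons s true) = set0.
Proof.
apply/seteqP; split=> // X [[Y [TY Y0]] [Z [TZ Z1]]].
move: Z1; rewrite TY in TZ; case: TZ => <- Y1.
by suff : (@set0 cantor) Y by []; rewrite -(cylI s).
Qed.

(** The true partial sums are superadditive. The credits of the two children add up to
    [4 ^- size s / 2], within the five eighths that [sum_small] leaves over at [s]. *)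
Lemma theta_super : superadditive theta.
Proof.
move=> s; have h b : theta (rcons s b) <= F (lvl s + 3) (rcons s b) + 4 ^- size s / 4.
  rewrite /theta size_rcons exprS invfM (mulrC 4^-1) lerD2r.
  have -> : lvl (rcons s b) = (lvl s + 2)%N by rewrite /lvl size_rcons; lia.
  rewrite addn2 -addn3; apply: ler_sum => n _; rewrite ler_pM2l //.
  apply: rm_le_dom => // X [[CX QX] DX]; split=> //.
  by apply: (@Q_preim (lvl s).+2).
have FD : F (lvl s + 3) (rcons s false) + F (lvl s + 3) (rcons s true) <= F (lvl s + 3) s.
  rewrite /F -big_split; apply: ler_sum => n _ /=; rewrite -mulrDr ler_pM2l //.
  apply: rm_disjoint_le => //.
  - by rewrite setIACA preim_disjoint setI0.
  - by move=> X [CX /preim_rcons].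
  - by move=> X [CX /preim_rcons].
have := sum_small (lvl s + 3) s; have := h false; have := h true.
have : 0 <= 4 ^- size s :> R by rewrite invr_ge0 exprn_ge0.
lra.
Qed.

Lemma comp_small k (n e : env k -> nat) : computable n -> computable e ->
  computable (fun x => (len (g (tk (st (n x)) (e x))) < n x)%N : nat).
Proof.
move=> hn he; apply: comp_leq => //; apply: comp_succ; apply: comp_len.
apply: (@comp_app1 k (fun x => g x.2)); first exact/computable1P.
by apply: comp_tk => //; apply: comp_st.
Qed.

Lemma len_g_tk n t : (n <= size t)%N -> len (g (tk n (enc t))) = size (phi (take n t)).
Proof. by move=> nt; rewrite tk_enc // g_enc len_enc. Qed.

(** As [st] is monotone, all sets involved are decided by the first [st (lvl s)] bits, and
    exchanging the sums leaves one finite sum over strings of that length. *)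
Lemma theta_computable : computable_weight theta.
Proof.
apply: weight_add; last first.
  apply: (@approx_ext _ 1 (fun x => 1%:R / 2 ^+ (2 * len x.2)%N)).
    by move=> x; rewrite size_dec mul1r exprM expr2 -natrM.
  apply: approx_shift; last by apply: (@approx_nat _ 1 (fun=> 1%N)); comp_tac.
  by apply: comp_mul; [comp_tac | exact: comp_len0].
have clv : @computable 1 (fun x => (2 * len x.2 + 3)%N).
  by apply: comp_add; [apply: comp_mul; [comp_tac | exact: comp_len0] | comp_tac].
apply: (@approx_ext _ 1 (fun x => \sum_(t <- strs (st (2 * len x.2 + 3)))
   (pref x.2 (g (enc t)) * \sum_(n < (2 * len x.2 + 3).+1)
      2 ^ n * (len (g (tk (st n) (enc t))) < n))%N%:R * wt mu t)).
  move=> [[] e] /=; set s := dec e.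
  have -> : (2 * len e + 3)%N = lvl s by rewrite /lvl /s size_dec.
  rewrite (eq_bigr (fun n : 'I_(lvl s).+1 => \sum_(t <- strs (st (lvl s)))
     2 ^+ n * (((size (phi (take (st n) t)) < n) && sprefix s (phi t))%N%:R * wt mu t))).
    rewrite exchange_big; apply: eq_big_seq => t /size_strs st_t.
    rewrite -[e]decK -/s g_enc pref_enc natrM natr_sum mulr_sumr mulr_suml.
    apply: eq_bigr => n _; rewrite len_g_tk ?st_t ?st_homo -1?ltnS //.
    by rewrite natrM natrX andbC -mulnb natrM; ring.
  move=> n _; rewrite -mulr_sumr; congr (_ * _).
  rewrite -(rm_restr fmu (st (lvl s))
    (fun t => (size (phi (take (st n) t)) < n)%N && sprefix s (phi t))).
  congr rm; apply/seteqP; split=> X; rewrite /C /Q /= take_restr ?st_homo -1?ltnS //.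
    by case=> -> ->.
  by case/andP.
apply: (@approx_strs R 1 (wt mu) _ (fun x e => (pref x.2 (g e) * \sum_(n < (2 * len x.2 + 3).+1)
      2 ^ n * (len (g (tk (st n) e)) < n))%N)) => //.
  exact: comp_st.
apply: comp_mul; first by apply: computable_pref_g; comp_tac.
apply: (@comp_sum 2 (fun p n => 2 ^ n * (len (g (tk (st n) p.2)) < n))%N).
  by apply: comp_mul; [comp_tac | apply: comp_small; comp_tac].
by apply: comp_succ; apply: (comp_weak clv).
Qed.

(** The bounded quantifier is written as a vanishing sum, whose computability is already
    available. *)
Definition ok n0 M (t : bits) : bool :=
  (\sum_(n < M.+1) ((n0 <= n) && (size (phi (take (st n) t)) < n)) == 0)%N.

Lemma okP n0 M X : ok n0 M (restr X (st M)) <->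
  forall n, (n0 <= n <= M)%N -> ~ C n X.
Proof.
rewrite /ok sum_nat_eq0; split=> [/forallP h n /andP[n0n nM]|h].
  have := h (Ordinal (nM : (n < M.+1)%N)); rewrite /= n0n take_restr ?st_homo //=.
  by rewrite eqb0 /C /= => /negP.
apply/forallP => -[n nM] /=; rewrite eqb0 take_restr ?st_homo //.
by apply/negP => /andP[n0n]; apply: h; rewrite n0n.
Qed.

Definition good n0 M s := [set X : cantor |
  sprefix s (phi (restr X (st M))) && ok n0 M (restr X (st M))].

Lemma measurable_good n0 M s : measurable (good n0 M s).
Proof. exact: (measurable_restr_pred _ (fun t => sprefix s (phi t) && ok n0 M t)). Qed.

(** A point of [preim s] outside every [C n] with [n0 <= n <= M] has shown [s] by stage [st M], so
    only these [C n] are lost. In [theta] each of them carries a factor of at least [2 ^+ n0]. *)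
Lemma good_large n0 M s : (n0 <= M)%N -> (size s <= M)%N ->
  2 ^+ n0 * (rm mu (preim s) - rm mu (good n0 M s)) <= theta s.
Proof.
move=> n0M sM.
pose V k := [set X : cantor | exists n, [/\ (n < k)%N, (n0 <= n)%N & C n X]].
have VS k : V k.+1 = V k `|` (if (n0 <= k)%N then C k else set0).
  apply/seteqP; split=> X.
    move=> [n []]; rewrite ltnS leq_eqVlt => /predU1P[->|nk] n0n CX; last by left; exists n.
    by right; rewrite n0n.
  move=> [[n [nk n0n CX]]|]; first by exists n; split=> //; apply: leqW.
  by case: ifP => // n0k CX; exists k.
have mV k : measurable (V k).
  elim: k => [|k IH].
    by rewrite (_ : V 0%N = set0) //; apply/seteqP; split=> // X [n []].
  by rewrite VS; apply: measurableU => //; case: ifP => // _; apply: measurable_C.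
have mPV k : measurable (preim s `&` V k).
  by apply: measurableI => //; apply: measurable_preim.
have h k : 2 ^+ n0 * rm mu (preim s `&` V k) <= F k s.
  elim: k => [|k IH].
    rewrite (_ : _ `&` _ = set0); last by apply/seteqP; split=> // X [_ [n []]].
    by rewrite /rm measure0 mulr0.
  rewrite VS /F big_ord_recr -/(F k s) /=; case: ifP => n0k; last first.
    rewrite setU0; apply: le_trans IH _; rewrite lerDl.
    by rewrite mulr_ge0 ?rm_ge0 // ltW.
  apply: (@le_trans _ _ (2 ^+ n0 * (rm mu (preim s `&` V k) + rm mu (C k `&` preim s)))).
    rewrite ler_pM2l // setIUr (setIC _ (C k)); exact: rmU_le.
  rewrite mulrDr lerD // ler_wpM2r ?rm_ge0 //.
  by rewrite -!natrX ler_nat leq_exp2l.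
have := sum_small M.+1 s; have := h M.+1.
have : 0 <= 4 ^- size s :> R by rewrite invr_ge0 exprn_ge0.
have : rm mu (preim s) - rm mu (good n0 M s) <= rm mu (preim s `&` V M.+1).
  rewrite lerBlDl.
  apply: le_trans (rmU_le fmu (measurable_good n0 M s) (mPV _)).
  apply: rm_le => //; [exact: measurable_preim | by apply: measurableU => //; apply: measurable_good |].
  move=> X PX; have [VX|nVX] := pselect (V M.+1 X); [by right | left].
  have nC n : (n0 <= n <= M)%N -> ~ C n X.
    by move=> /andP[n0n nM] CX; apply: nVX; exists n.
  apply/andP; split; last exact/okP.
  by case: (preim_sub sM PX) => // /nC; case; rewrite n0M leqnn.
rewrite -(ler_pM2l (p2 n0)); lra.
Qed.

(** * The weight of a single test *)

Section Test.
Variables (kappa : {measure set cantor -> \bar R}) (n0 : nat).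
Hypothesis ckappa : computable_measure kappa.

Let fk : finite_cyl kappa := ((computable_measureP kappa).1 ckappa).1.
Let wk : computable_weight (wt kappa) := ((computable_measureP kappa).1 ckappa).2.

Definition good_weight s : R := rm kappa (good n0 (n0 + size s) s).

(** [T] may be undefined on a set of positive [kappa]-measure, so the nesting is proved point by
    point: outside [C (n0 + size s)] the earlier stage already has [size s] bits of output, which
    must be those of [s]. *)
Lemma good_weight_super : superadditive good_weight.
Proof.
move=> s; rewrite /good_weight !size_rcons addnS.
have sub b : good n0 (n0 + size s).+1 (rcons s b) `<=` good n0 (n0 + size s) s.
  move=> X /andP[sX /okP okX].
  have nC n : (n0 <= n <= n0 + size s)%N -> ~ C n X.
    by move=> /andP[n0n nM]; apply: okX; rewrite n0n leqW.
  apply/andP; split; last exact/okP.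
  apply: phi_prefix (sprefix_trans (sprefix_rcons s b) sX) _.
  have := nC (n0 + size s)%N; rewrite leq_addr leqnn /C /= => /(_ isT) /negP.
  by rewrite -leqNgt; apply: leq_trans; rewrite leq_addl.
apply: rm_disjoint_le => //; try exact: measurable_good.
apply/seteqP; split=> // X [/andP[s0 _] /andP[s1 _]].
exact: sprefix_split s0 s1.
Qed.

Lemma good_weight_computable : computable_weight good_weight.
Proof.
have cM : @computable 1 (fun x => (n0 + len x.2)%N).
  by apply: comp_add; [comp_tac | exact: comp_len0].
apply: (@approx_ext _ 1 (fun x => \sum_(t <- strs (st (n0 + len x.2)))
   (pref x.2 (g (enc t)) && (\sum_(n < (n0 + len x.2).+1)
      ((n0 <= n) && (len (g (tk (st n) (enc t))) < n)) == 0))%N%:R * wt kappa t)).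
  move=> [[] e] /=; set s := dec e; rewrite -/(len _) /good_weight /good -/s size_dec.
  rewrite (rm_restr fk (st (n0 + len e))
    (fun t => sprefix s (phi t) && ok n0 (n0 + len e) t)).
  apply: eq_big_seq => t /size_strs st_t; congr (_%:R * _); congr nat_of_bool.
  rewrite -[e in pref e _]decK -/s g_enc pref_enc /ok; congr (_ && (_ == _)).
  apply: eq_bigr => n _; rewrite len_g_tk // st_t st_homo //.
  by rewrite -ltnS.
apply: (@approx_strs R 1 (wt kappa) _ (fun x e => (pref x.2 (g e) &&
    (\sum_(n < (n0 + len x.2).+1) ((n0 <= n) && (len (g (tk (st n) e)) < n)) == 0))%N)) => //.
  exact: comp_st.
apply: comp_and; first by apply: computable_pref_g; comp_tac.
apply: comp_eq; last by comp_tac.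
apply: (@comp_sum 2 (fun p n => (n0 <= n) && (len (g (tk (st n) p.2)) < n))%N).
  by apply: comp_and; [comp_tac | apply: comp_small; comp_tac].
by apply: comp_succ; apply: (comp_weak cM).
Qed.

(** The domain is a finite union of cylinders of one length, and the bound by [kappa] is applied on
    each. *)
Lemma good_weight_integral (t : cantor -> \bar R) s :
  measurable_fun setT t -> (forall X, 0 <= t X)%E ->
  (forall s, \int[mu]_(X in cyl s) t X <= kappa (cyl s))%E ->
  (\int[mu]_(X in good n0 (n0 + size s) s) t X <= (good_weight s)%:E)%E.
Proof.
move=> mt t0 t_kappa; rewrite /good_weight /good.
set N := st _; pose b u := sprefix s (phi u) && ok n0 (n0 + size s) u.
rewrite (rm_restr fk N b) (@additive_restr R (fun A => \int[mu]_(X in A) t X)%E N b).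
- rewrite -sumEFin; apply: lee_sum => u _; case: (b u); last by rewrite mul0r.
  by rewrite mul1r -wtE.
- move=> A B mA mB AB; apply: ge0_integral_setU => //.
    exact: measurable_funS mt.
  exact/disj_set2P.
- by rewrite integral_set0.
Qed.
End Test.
End Stages.
End Map.

(** * Choosing a preimage that passes all tests *)

Section LowerSemicomputable.
Context {R : realType}.
Implicit Types t : cantor -> \bar R.

Lemma lower_semicomputable_ge0 t : lower_semicomputable t -> forall X, (0 <= t X)%E.
Proof. by move=> [w [p [q [_ [_ [_ tE]]]]]] X; rewrite tE; apply: ereal_sup_ubound; left. Qed.

Lemma lower_semicomputable_measurable t : lower_semicomputable t -> measurable_fun setT t.
Proof.
move=> [w [p [q [_ [_ [_ tE]]]]]].
apply: (measurability _ (ErealGenOInfty.measurableE R)).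
move=> _ [_ [x ->] <-]; rewrite setTI preimage_itvoy.
pose F k : set cantor := if x < qv (p k) (q k) then cyl (w k) else set0.
have -> : [set X | x%:E < t X]%E = (if x < 0 then setT else set0) `|` \bigcup_k F k.
  apply/seteqP; split=> X /=; rewrite tE.
    move=> /ereal_sup_gt[_ [->|[k wX <-]]]; rewrite lte_fin => xq; first by left; rewrite xq.
    by right; exists k => //; rewrite /F xq.
  move=> [|[k _]]; first case: ifP => // x0 _; last (rewrite /F; case: ifP => // xq wX).
    by apply: (@lt_le_trans _ _ 0%E); [rewrite lte_fin | apply: ereal_sup_ubound; left].
  apply: (@lt_le_trans _ _ (qv (p k) (q k))%:E); first by rewrite lte_fin.
  by apply: ereal_sup_ubound; right; exists k.
apply: measurableU; first by case: ifP.
by apply: bigcupT_measurable => k; rewrite /F; case: ifP => // _; apply: measurable_cyl.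
Qed.

(** A value above [c] would be witnessed on a single cylinder around [X], which contains [Z] as soon
    as [Z] agrees with [X] far enough. The premise on [c] accounts for the 0 adjoined to the
    supremum. *)
Lemma lower_semicomputable_le t X c : lower_semicomputable t -> (0 <= c)%E ->
  (forall n, exists2 Z : cantor, restr Z n = restr X n & (t Z <= c)%E) -> (t X <= c)%E.
Proof.
move=> [w [p [q [_ [_ [_ tE]]]]]] c0 h; rewrite tE.
apply: ge_ereal_sup => _ [->//|[k /is_prefixE wX <-]].
have [Z ZX tZ] := h (size (w k)); apply: le_trans tZ; rewrite tE; apply: ereal_sup_ubound; right; exists k => //.
by apply/is_prefixE; rewrite ZX.
Qed.

Lemma lower_semicomputable0 : @lower_semicomputable R (cst 0%E).
Proof.
exists (fun=> [::]), (fun=> 0%N), (fun=> 0%N).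
do 3! [split; first by apply/computable1P; comp_tac].
move=> X; apply/eqP; rewrite eq_le; apply/andP; split; first by apply: ereal_sup_ubound; left.
by apply: ge_ereal_sup => _ [->//|[k _ <-]]; rewrite /qv mul0r.
Qed.

(** Indices are numbers of triples of codes. The enumeration is classical, not effective: an index
    that codes no member of [P] is sent to [t0]. *)
Lemma lower_semicomputable_enum (P : set (cantor -> \bar R)) t0 :
  P `<=` [set t | lower_semicomputable t] -> P t0 ->
  exists u : nat -> cantor -> \bar R, (forall i, P (u i)) /\
    forall t, P t -> exists i, u i = t.
Proof.
move=> Plsc Pt0.
pose coded (i : nat) t := exists w p q c1 c2 c3,
  [/\ forall a, Defs.eval c1 [:: a] (enc (w a)), forall a, Defs.eval c2 [:: a] (p a),
      forall a, Defs.eval c3 [:: a] (q a),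
      i = pickle (code_tree c1, code_tree c2, code_tree c3) &
      forall X : cantor, t X = ereal_sup ([set 0%E] `|`
        [set (qv (p k) (q k) : R)%:E | k in [set k | is_prefix (w k) X]])].
have coded_inj i t t' : coded i t -> coded i t' -> t = t'.
  move=> [w [p [q [c1 [c2 [c3 [h1 h2 h3 hi tE]]]]]]].
  move=> [w' [p' [q' [d1 [d2 [d3 [h1' h2' h3' hi' tE']]]]]]].
  move: hi'; rewrite hi => /(pcan_inj pickleK)[/code_tree_inj e1 /code_tree_inj e2].
  move=> /code_tree_inj e3; subst d1 d2 d3.
  have ew : w = w' by apply/funext => a; apply: enc_inj; apply: eval_inj (h1 a) (h1' a).
  have ep : p = p' by apply/funext => a; apply: eval_inj (h2 a) (h2' a).
  have eq : q = q' by apply/funext => a; apply: eval_inj (h3 a) (h3' a).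
  by apply/funext => X; rewrite tE tE' ew ep eq.
have /choice[u uP] : forall i, exists v, P v /\ forall t, P t -> coded i t -> v = t.
  move=> i.
  have [[t [Pt ct]]|no] := pselect (exists t, P t /\ coded i t).
    by exists t; split=> // t' _; apply: coded_inj ct.
  by exists t0; split=> // t Pt ct; case: no; exists t.
exists u; split; first by move=> i; have [] := uP i.
move=> t Pt; have [w [p [q [[c1 h1] [[c2 h2] [[c3 h3] tE]]]]]] := Plsc t Pt.
exists (pickle (code_tree c1, code_tree c2, code_tree c3)).
have [_] := uP (pickle (code_tree c1, code_tree c2, code_tree c3)); apply=> //.
by exists w, p, q, c1, c2, c3.
Qed.
End LowerSemicomputable.

Lemma cantor_cluster (u : nat -> cantor) :
  exists X : cantor, forall n k, exists2 m, (k <= m)%N & restr (u m) n = restr X n.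
Proof.
(* [s] begins infinitely many of the [u m]. As in Koenig's lemma, the limit takes the bit 1 whenever
   this preserves the property; otherwise the bit 0 must. *)
pose inf s := forall k, exists2 m, (k <= m)%N & restr (u m) (size s) = s.
have infS s : inf s -> inf (rcons s `[< inf (rcons s true) >]).
  move=> infs; case: asboolP => // /existsNP[k0 no] k.
  have [m km us] := infs (maxn k k0).
  exists m; first by apply: leq_trans km; rewrite leq_maxl.
  rewrite size_rcons restrS us; congr rcons; apply/negbTE/negP => um.
  apply: no; exists m; first by apply: leq_trans km; rewrite leq_maxr.
  by rewrite size_rcons restrS us um.
pose s n := nat_rect (fun=> bits) [::] (fun _ s => rcons s `[< inf (rcons s true) >]) n.
pose X : cantor := fun n => `[< inf (rcons (s n) true) >].
have XE n : restr X n = s n by elim: n => // n IH; rewrite restrS IH.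
exists X => n k; have infn : inf (restr X n).
  elim: n => [|n IH]; first by move=> j; exists j.
  by rewrite restrS /X -XE; apply: infS.
by have [m km] := infn k; rewrite size_restr; exists m.
Qed.

Section SumTest.
Context {R : realType}.
Variables (mu : {measure set cantor -> \bar R}) (S : set cantor).
Hypothesis mS : measurable S.

(* Markov's inequality for a weighted sum of countably many tests. *)
Lemma exists_small_sum (u : nat -> cantor -> \bar R) (B : nat -> R) (v : R) :
  (forall i, measurable_fun setT (u i)) -> (forall i X, 0 <= u i X)%E ->
  (forall i, 0 < B i) -> 0 <= v ->
  (forall i, \int[mu]_(X in S) u i X <= (B i * v)%:E)%E ->
  ((v / 2)%:E < mu S)%E ->
  exists2 X, S X & forall i, (u i X <= (B i * 2 ^+ i.+2)%:E)%E.
Proof.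
move=> mu_ u0 B0 v0 int_u vS; apply: contrapT => no.
(* With these weights the [i]-th term has integral at most [v / 2 ^+ i.+2], in total [v / 2], less
   than [mu S]. So the weighted sum is below 1 somewhere in [S], and there every term is. *)
pose a i : R := (B i * 2 ^+ i.+2)^-1.
have a0 i : 0 < a i by rewrite invr_gt0 mulr_gt0 ?exprn_gt0.
pose w X : \bar R := (\sum_(i <oo) (a i)%:E * u i X)%E.
have au0 i X : (0 <= (a i)%:E * u i X)%E by rewrite mule_ge0 // lee_fin ltW.
have w1 X : S X -> (1 <= w X)%E.
  move=> SX; apply: contrapT => /negP; rewrite -ltNge => w1; apply: no; exists X => // i.
  have : ((a i)%:E * u i X <= w X)%E.
    apply: le_trans (@nneseries_lim_ge R (fun i => (a i)%:E * u i X)%E xpredT 0 i.+1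
      (fun n _ _ => au0 n X)).
    by rewrite big_nat_recr //= leeDr // sume_ge0.
  move=> /le_lt_trans/(_ w1)/ltW.
  rewrite -[(B i * _)]invrK -/(a i) muleC -lee_pdivlMr //.
  by rewrite mul1e.
suff : (mu S <= (v / 2)%:E)%E by rewrite leNgt vS.
have mau i : measurable_fun S (fun X => (a i)%:E * u i X)%E.
  by apply: measurable_funeM; apply: measurable_funS (mu_ i).
have -> : mu S = (\int[mu]_(X in S) cst 1%E X)%E by rewrite integral_cst // mul1e.
apply: (@le_trans _ _ (\int[mu]_(X in S) w X)%E).
  apply: ge0_le_integral => //; last by apply: ge0_emeasurable_sum => // i X _ _; apply: au0.
rewrite integral_nneseries //.
apply: le_trans (@epsilon_trick0 R (v / 2) xpredT _); last by rewrite divr_ge0.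
apply: lee_nneseries; first by move=> i _ _; apply: integral_ge0 => X _; apply: au0.
move=> i _; rewrite ge0_integralZl_EFin //; [|exact: measurable_funS (mu_ i)|exact: ltW].
apply: le_trans (lee_wpmul2l _ (int_u i)) _; first by rewrite lee_fin ltW.
rewrite -EFinM lee_fin /a natrX le_eqVlt; apply/orP; left; apply/eqP.
rewrite exprS; field.
by rewrite expf_neq0 // gt_eqF.
Qed.
End SumTest.

Lemma random_preimage (R : realType) (mu : {measure set cantor -> \bar R})
  (T : cantor -> option cantor) (nu : {measure set cantor -> \bar R}) (Y : cantor) :
  mu setT = 1%E -> computable_measure mu -> ae_computable mu T ->
  is_pushforward mu nu T -> computably_random nu Y ->
  exists X : cantor, computably_random mu X /\ T X = Some Y.
Proof.
move=> mu1 cmu [[phi [g [cg [g_enc [phi_mono TP]]]]] mu_dom] nuE rY.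
have [st [c_st st_homo st_small]] := stages cg g_enc phi_mono TP cmu mu1 mu_dom.
have [cnu nu_preim] := computable_pushforward cg g_enc phi_mono TP cmu mu1 mu_dom c_st st_small nuE.
have bounded G (G0 : forall s, 0 <= G s) (Gs : superadditive G) (cG : computable_weight G) :=
  random_bounded G0 Gs cG cnu rY.
pose v m := wt nu (restr Y m).
have [B0 B0P] := bounded _ (theta_ge0 mu phi st)
  (theta_super phi_mono TP cmu mu1 mu_dom st_small)
  (theta_computable cg g_enc cmu c_st st_homo).
have v_gt0 m : 0 < v m.
  rewrite lt_neqAle wt_ge0 andbT eq_sym; apply/eqP => v0.
  have := B0P m; rewrite -/(v m) v0 mulr0 leNgt => /negP; apply.
  by rewrite ltr_wpDl ?theta_ge0 // invr_gt0 exprn_gt0.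
have bound_gt0 G B m : 0 <= G (restr Y m) ->
    G (restr Y m) + 2 ^- m <= B * wt nu (restr Y m) -> 0 < B.
  move=> G0 h; rewrite -(pmulr_lgt0 _ (v_gt0 m)); apply: lt_le_trans h.
  by rewrite ltr_wpDl // invr_gt0 exprn_gt0.
have B0_gt0 : 0 < B0 by apply: bound_gt0 (B0P 0%N); apply: theta_ge0.
(* By [good_large] the loss is at most [B0 * v m / 2 ^+ n0], a quarter of [v m]; what remains
   exceeds the [v m / 2] needed for Markov's inequality. *)
pose n0 := Num.bound (4 * B0).
have n0P : 4 * B0 <= 2 ^+ n0.
  apply: le_trans (ltr_natX n0); apply/ltW/archi_boundP.
  by rewrite mulr_ge0 // ltW.
pose S m := good phi st n0 (n0 + m) (restr Y m).
have mS m : measurable (S m) by apply: measurable_good.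
have fmu : finite_cyl mu := ((computable_measureP mu).1 cmu).1.
have S_large m : ((v m / 2)%:E < mu (S m))%E.
  rewrite (rmE fmu) // lte_fin.
  have := @good_large R mu T phi phi_mono TP cmu st st_homo st_small
    n0 (n0 + m)%N (restr Y m).
  rewrite size_restr leq_addr leq_addl -nu_preim -/(v m) -/(S m) => /(_ isT isT) h.
  have p : 0 < 2 ^+ n0 :> R by rewrite exprn_gt0.
  have : 2 ^+ n0 * (v m - rm mu (S m)) <= 2 ^+ n0 * (v m / 4).
    apply: le_trans h _; apply: (@le_trans _ _ (B0 * v m)).
      apply: le_trans (B0P m); rewrite lerDl invr_ge0 exprn_ge0 //.
    have : 4 * B0 * v m <= 2 ^+ n0 * v m by rewrite ler_pM2r.
    lra.
  by rewrite ler_pM2l //; have := v_gt0 m; lra.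
pose test := [set t : cantor -> \bar R | lower_semicomputable t /\
  exists kappa : {measure set cantor -> \bar R}, computable_measure kappa /\
    forall s, (\int[mu]_(x in cyl s) t x <= kappa (cyl s))%E].
have test0 : test (cst 0%E).
  split; first exact: lower_semicomputable0.
  by exists mu; split=> // s; rewrite integral0.
have test_lsc : test `<=` [set t | lower_semicomputable t] by move=> t [].
have [u [u_test u_all]] := lower_semicomputable_enum test_lsc test0.
have u_lsc i := (u_test i).1.
(* Each test brings its own [kappa] and its own use of the randomness of [Y]. The constant depends
   on the test but not on [m], which is what survives the limit. *)
have /choice[B BP] : forall i, exists b : R, 0 < b /\
    forall m, (\int[mu]_(X in S m) u i X <= (b * v m)%:E)%E.
  move=> i; have [lsc [kappa [ckappa tk]]] := u_test i.
  have G0 s : 0 <= good_weight phi st kappa n0 s by apply: rm_ge0.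
  have [b bP] := bounded _ G0 (good_weight_super phi_mono st_homo n0 ckappa)
    (good_weight_computable cg g_enc c_st st_homo n0 ckappa).
  exists b; split; first exact: bound_gt0 (bP 0%N).
  move=> m; have := good_weight_integral phi st n0 ckappa (restr Y m)
    (lower_semicomputable_measurable lsc) (lower_semicomputable_ge0 lsc) tk.
  rewrite size_restr => /le_trans; apply; rewrite lee_fin.
  by apply: le_trans (bP m); rewrite lerDl invr_ge0 exprn_ge0.
have /choice[Z ZP] : forall m, exists X, S m X /\
    forall i, (u i X <= (B i * 2 ^+ i.+2)%:E)%E.
  move=> m; have [] := @exists_small_sum R mu (S m) (mS m) u B (v m).
  - by move=> i; apply: lower_semicomputable_measurable.
  - by move=> i; apply: lower_semicomputable_ge0.
  - by move=> i; have [] := BP i.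
  - exact: ltW.
  - by move=> i; have [_] := BP i.
  - exact: S_large.
  by move=> X SX uX; exists X.
have [X XP] := cantor_cluster Z; exists X; split.
  move=> t kappa lsc ckappa tk.
  have [i <-] : exists i, u i = t by apply: u_all; split=> //; exists kappa.
  apply: (@le_lt_trans _ _ (B i * 2 ^+ i.+2)%:E); last exact: ltry.
  apply: (lower_semicomputable_le (u_lsc i)).
    by rewrite lee_fin mulr_ge0 ?exprn_ge0 // ltW //; have [] := BP i.
  move=> n; have [m _ mX] := XP n 0%N; exists (Z m) => //.
  by have [_] := ZP m.
have okZ m n : (n0 <= n <= n0 + m)%N -> (n <= size (phi (restr (Z m) (st n))))%N.
  have [/andP[_ /(okP phi st_homo) h] _] := ZP m.
  by move=> /h; rewrite /C /= => /negP; rewrite -leqNgt.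
apply/TP; split=> [n|m].
  set s := phi (restr X n).
  (* Since [Z m] agrees with [X] on [n] bits, [s] begins the output on [Z m], as does the prefix of
     [Y] of length [m]. Being both prefixes of one string, they are comparable, and [m] is at least
     [size s]. *)
  have [m km mX] := XP n (maxn (size s) n).
  have [/andP[Ym _] _] := ZP m.
  have sm : (size s <= m)%N by apply: leq_trans km; rewrite leq_maxl.
  have sZ : sprefix s (phi (restr (Z m) (st (n0 + m)))).
    apply: (phi_prefix phi_mono (k := n)); first by rewrite mX sprefix_refl.
    apply: leq_trans sm _; apply: leq_trans (sprefix_size Ym).
    by rewrite size_restr.
  have sY : sprefix s (restr Y m).
    by apply: sprefix_comparable sZ Ym _; rewrite size_restr.
  have sm' : (size s <= size (restr Y m))%N by rewrite size_restr.
  have pY : is_prefix (restr Y m) Y by apply: is_prefix_restr.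
  exact: (is_prefix_sprefix sm' pY).2 sY.
(* Agreement of [X] with some [Z j] on this many bits carries the output length over to [X];
   [j >= m] puts [n0 + m] in the range controlled on [Z j]. *)
exists (st (n0 + m)).
have [j kj jX] := XP (st (n0 + m)) m.
rewrite -jX; apply: leq_trans (okZ j (n0 + m)%N _); first exact: leq_addl.
by rewrite leq_addr leq_add2l.
Qed.

Theorem mainTheorem9 (R : realType) (mu : probability cantor R)
  (T : cantor -> option cantor) (nu : {measure set cantor -> \bar R})
  (Y : cantor) :
  computable_measure mu ->
  ae_computable mu T ->
  is_pushforward mu nu T ->
  computably_random nu Y ->
  exists X : cantor, computably_random mu X /\ T X = Some Y.
Proof. by apply: random_preimage; apply: probability_setT. Qed.
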